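(* Suppose $k\ge3$. On a cuboid cell $T$, the following set of degrees of freedom is unisolvent for the shape function space $\mathcal Q_{k,k,k}$: for $u\in\mathcal Q_{k,k,k}$, (1) $\partial_1^{\alpha_1}\partial_2^{\alpha_2}\partial_3^{\alpha_3}u(\boldsymbol x)$, $\alpha\in\{0,1\}^3$, at each vertex $\boldsymbol x$ of $T$; (2) the moments of $u,\ \partial_ju,\ \partial_lu,\ \partial_j\partial_lu$ on each edge $e_i$ of $T$ against $\mathcal Q(i{:}k-4)$, $i=1,2,3$; (3) the moments of $u,\ \partial_lu$ on each face $F_{ij}$ of $T$ against $\mathcal Q(i{:}k-4,j{:}k-4)$; (4) the moments of $u$ on $T$ against $\mathcal Q_{k-4,k-4,k-4}$. Moreover, the resulting finite element space $U_h$ on $\mathcal T_h$ is $H^2$ conforming, i.e. $U_h\subset H^2(\Omega)$.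
   Context: Coordinates are $(x_1,x_2,x_3)=(x,y,z)$, $\partial_i=\partial/\partial x_i$. Whenever indices $i,j,l$ occur together they are pairwise distinct, i.e. $\{i,j,l\}=\{1,2,3\}$. $\mathcal Q(i{:}a,j{:}b,l{:}c)$ is the space of polynomials of degree at most $a$ in $x_i$, at most $b$ in $x_j$ and at most $c$ in $x_l$ (separately); similarly with fewer variables on faces and edges; it is the zero space if some bound is negative (the corresponding degrees of freedom are then absent). $\mathcal Q_{a,b,c}=\mathcal Q(1{:}a,2{:}b,3{:}c)$. $\Omega\subset\mathbb R^3$ is a contractible domain with Lipschitz boundary, partitioned by a (face-to-face) mesh $\mathcal T_h$ of axis-parallel cuboids. $e_i$ denotes an edge parallel to the $x_i$-axis; $F_{ij}=F_{ji}$ denotes a face parallel to the $x_i$- and $x_j$-axes. ''Moments of $f$ on $G$ against $P$'' means the functionals $\int_G f\,p$, $p\in P$ (with $p$ running over a basis of $P$ when counting). Degrees of freedom are unisolvent for a shape function space if they form a basis of its dual space. The resulting finite element space consists of all functions on $\Omega$ whose restriction to each cell is in the shape function space and such that each degree of freedom attached to a vertex, edge or face has the same value from all cells containing that vertex, edge or face. *)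

(* Defs.v *)
From HB Require Import structures.
From mathcomp Require Import all_boot all_order all_algebra.
From mathcomp Require Import all_classical all_reals all_analysis.

Set Implicit Arguments.
Unset Strict Implicit.
Unset Printing Implicit Defensive.

Import Order.TTheory GRing.Theory Num.Theory.
Import numFieldNormedType.Exports.

Local Open Scope classical_set_scope.
Local Open Scope ring_scope.

Section Space.
Context {R : realType}.

(* The coordinates x_1, x_2, x_3 have indices 0, 1, 2 : 'I_3. *)
Definition space3 : Type := (R * R * R)%type.

Definition coord (x : space3) (i : 'I_3) : R :=
  match val i with 0 => x.1.1 | 1 => x.1.2 | _ => x.2 end.

Definition mkspace3 (f : 'I_3 -> R) : space3 :=
  (f (inord 0), f (inord 1), f (inord 2)).

Definition basis_vector (i : 'I_3) : space3 := mkspace3 (fun j => (j == i)%:R).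

Definition partial (i : 'I_3) (f : space3 -> R) : space3 -> R :=
  fun x => 'D_(basis_vector i) f x.

Definition multi_partial (alpha : 'I_3 -> nat) (f : space3 -> R) :
    space3 -> R :=
  iter (alpha (inord 0)) (partial (inord 0))
    (iter (alpha (inord 1)) (partial (inord 1))
      (iter (alpha (inord 2)) (partial (inord 2)) f)).

Definition lebesgue3 :
    {measure set (measurableTypeR R * measurableTypeR R * measurableTypeR R)
       -> \bar R} :=
  ((lebesgue_measure \x lebesgue_measure) \x lebesgue_measure)%E.

(* Sobolev space H^2(Omega). Functions are total; only their values on Omega
   matter. *)

Definition smooth (f : space3 -> R) : Prop :=
  forall s : seq 'I_3, let g := foldr partial f s in
    continuous g /\ forall i x, derivable g x (basis_vector i).

Definition test_function (Omega : set space3) : set (space3 -> R) :=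
  [set phi | smooth phi /\
     let supp := closure [set x | phi x != 0] in
     compact supp /\ supp `<=` Omega].

Definition L2 (Omega : set space3) : set (space3 -> R) :=
  [set f | f \_ Omega \in Lfun lebesgue3 2%:E].

Definition weak_partial (Omega : set space3) (alpha : 'I_3 -> nat)
    (u v : space3 -> R) : Prop :=
  forall phi, test_function Omega phi ->
    \int[lebesgue3]_(x in Omega) (u x * multi_partial alpha phi x) =
    (-1) ^+ (\sum_i alpha i)%N * \int[lebesgue3]_(x in Omega) (v x * phi x).

(* The elements of H^2 are classes of functions modulo almost everywhere
   equality, hence the (measurable) representative w of u. *)
Definition sobolevH2 (Omega : set space3) : set (space3 -> R) :=
  [set u | exists w : space3 -> R,
     [/\ u = w %[ae lebesgue3 in Omega],
         L2 Omega w
       & forall alpha : 'I_3 -> nat, (\sum_i alpha i <= 2)%N ->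
           exists v, L2 Omega v /\ weak_partial Omega alpha w v]].

Definition contractible (Omega : set space3) : Prop :=
  exists (c : space3) (H : R * space3 -> space3),
    [/\ Omega c,
        {within `[0, 1] `*` Omega, continuous H},
        forall t x, 0 <= t <= 1 -> Omega x -> Omega (H (t, x)),
        forall x, Omega x -> H (0, x) = x
      & forall x, Omega x -> H (1, x) = c].

(* Around each boundary point x0, in suitable orthonormal coordinates centred
   at x0 (the columns of Q being the axes), Omega is the part of a box lying
   strictly below the graph of a Lipschitz function. *)
Definition lipschitz_boundary (Omega : set space3) : Prop :=
  forall x0, (closure Omega `\` Omega°) x0 ->
  exists (Q : 'M[R]_3) (r h : R) (g : R * R -> R),
    [/\ Q *m Q^T = 1%:M, 0 < r, 0 < h, [lipschitz g x | x in setT] &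
      forall x : space3,
        let y := (\row_i (coord x i - coord x0 i)) *m Q in
        `|y 0 (inord 0)| < r -> `|y 0 (inord 1)| < r ->
        `|y 0 (inord 2)| < h ->
        (Omega x <-> y 0 (inord 2) < g (y 0 (inord 0), y 0 (inord 1)))].

(* A pair (lo, hi) encodes the axis-parallel box of the x with
   lo_i <= x_i <= hi_i for all i. Boxes may be flat: they also encode the
   vertices, edges and faces of cuboids, the axis i being parallel to the box
   if lo_i < hi_i. *)
Definition box : Type := (space3 * space3)%type.

Definition lo (G : box) (i : 'I_3) : R := coord G.1 i.
Definition hi (G : box) (i : 'I_3) : R := coord G.2 i.

Definition box_set (G : box) : set space3 :=
  [set x | forall i, lo G i <= coord x i <= hi G i].

Definition parallel (G : box) (i : 'I_3) : bool := lo G i < hi G i.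

Definition box_dim (G : box) : nat := #|[set i | parallel G i]%SET|.

Definition cuboid (T : box) : Prop := forall i, parallel T i.

(* The 27 vertices, edges, faces of T and T itself: along each axis take the
   whole interval (None), its lower end (Some false) or its upper end
   (Some true). *)
Definition sub_box (T : box) (s : 'I_3 -> option bool) : box :=
  (mkspace3 (fun i => if s i is Some true then hi T i else lo T i),
   mkspace3 (fun i => if s i is Some false then lo T i else hi T i)).

Definition entities (T : box) : seq box :=
  [seq sub_box T s | s : {ffun 'I_3 -> option bool}].

(* Integral over a box with respect to its own dimension (length, area or
   volume), iterated over the axes parallel to it. *)
Definition int_axis (a b : R) (f : R -> R) : R :=
  if a < b then \int[lebesgue_measure]_(t in `[a, b]) f t else f a.

Definition int_box (G : box) (f : space3 -> R) : R :=
  int_axis (lo G (inord 0)) (hi G (inord 0)) (fun x1 =>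
  int_axis (lo G (inord 1)) (hi G (inord 1)) (fun x2 =>
  int_axis (lo G (inord 2)) (hi G (inord 2)) (fun x3 => f (x1, x2, x3)))).

(* Polynomials of degree < a in x_1, < b in x_2, < c in x_3, given by their
   coefficients; this is Q_{a-1,b-1,c-1}, the zero space if a, b or c is 0. *)
Definition Qpoly (a b c : nat) : vectType R :=
  {ffun 'I_a * 'I_b * 'I_c -> R^o}.

Definition Qeval (a b c : nat) (q : Qpoly a b c) (x : space3) : R :=
  \sum_(e : 'I_a * 'I_b * 'I_c)
    (q : {ffun 'I_a * 'I_b * 'I_c -> R^o}) e *
    (x.1.1 ^+ e.1.1 * x.1.2 ^+ e.1.2 * x.2 ^+ e.2).

Definition shape_space (k : nat) : vectType R := Qpoly k.+1 k.+1 k.+1.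

(* Polynomials on G of degree at most k - 4 (i.e. < k - 3) in each variable
   parallel to G; they are constant in the other variables. *)
Definition moment_space (k : nat) (G : box) : vectType R :=
  let size i := if parallel G i then (k - 3)%N else 1%N in
  Qpoly (size (inord 0)) (size (inord 1)) (size (inord 2)).

Definition moment_eval (k : nat) (G : box) (q : moment_space k G)
  (x : space3) : R := Qeval q x.

Definition order01 := {ffun 'I_3 -> bool}.

Definition vertex_dof (k : nat) (x : space3) (alpha : order01)
    (u : shape_space k) : R :=
  multi_partial (fun i => alpha i) (Qeval u) x.

Definition moment (k : nat) (G : box) (alpha : order01)
    (q : moment_space k G) (u : shape_space k) : R :=
  int_box G (fun x =>
    multi_partial (fun i => alpha i) (Qeval u) x * moment_eval q x).

(* Derivatives only across G: u, d_j u, d_l u, d_j d_l u on an edge e_i;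
   u, d_l u on a face F_ij; u on a cell. *)
Definition normal_to (G : box) (alpha : order01) : bool :=
  [forall i, parallel G i ==> ~~ alpha i].

Definition vertex_dofs (k : nat) (T : box) : seq (shape_space k -> R) :=
  [seq vertex_dof G.1 alpha
     | G <- [seq G <- entities T | box_dim G == 0%N], alpha <- enum order01].

(* Moments on the d-dimensional entities of T, the test polynomials for the
   moments of the derivative alpha on G running over b G alpha. *)
Definition moment_dofs (k : nat) (T : box)
    (b : forall G : box, order01 -> seq (moment_space k G)) (d : nat) :
    seq (shape_space k -> R) :=
  flatten [seq [seq moment Ga.2 q | q <- b Ga.1 Ga.2]
    | Ga <- [seq (G, alpha) | G <- entities T, alpha <- enum order01]
    & (box_dim Ga.1 == d) && normal_to Ga.1 Ga.2].

Definition dofs (k : nat) (T : box)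
    (b : forall G : box, order01 -> seq (moment_space k G)) :
    seq (shape_space k -> R) :=
  vertex_dofs k T ++ moment_dofs T b 1 ++ moment_dofs T b 2
  ++ moment_dofs T b 3.

(* linfun l is l itself when l is linear, and a junk value otherwise, hence
   the first conjunct. *)
Definition unisolvent (V : vectType R) (L : seq (V -> R)) : Prop :=
  (forall l, l \in L -> linear (l : V -> R^o)) /\
  basis_of {: 'Hom(V, R^o)} [seq linfun (l : V -> R^o) | l <- L].

Definition is_mesh (Omega : set space3) (Th : seq box) : Prop :=
  [/\ forall T : box, T \in Th -> cuboid T,
      closure Omega = \bigcup_(T in [set` Th]) box_set T,
      forall T T' : box, T \in Th -> T' \in Th -> T != T' ->
        (box_set T)° `&` (box_set T')° = set0
    & forall T T' : box, T \in Th -> T' \in Th -> T != T' ->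
        box_set T `&` box_set T' = set0 \/
        exists G : box, [/\ G \in entities T, G \in entities T'
                    & box_set T `&` box_set T' = box_set G]].

(* The function u restricts to the polynomial p T on each cell T, values on
   the faces of cells being left free (u may a priori jump there), and the
   p T have common vertex, edge and face degrees of freedom. *)
Definition fe_space (k : nat) (Omega : set space3) (Th : seq box) :
    set (space3 -> R) :=
  [set u | exists p : box -> shape_space k,
    [/\ forall (T : box) x, T \in Th -> Omega x -> (box_set T)° x ->
          u x = Qeval (p T) x,
        forall (T T' G : box) alpha, T \in Th -> T' \in Th ->
          G \in entities T -> box_dim G = 0%N -> box_set G `<=` box_set T' ->
          vertex_dof G.1 alpha (p T) = vertex_dof G.1 alpha (p T')
      & forall (T T' G : box) alpha (q : moment_space k G),
          T \in Th -> T' \in Th -> G \in entities T -> (1 <= box_dim G <= 2)%N ->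
          box_set G `<=` box_set T' -> normal_to G alpha ->
          moment alpha q (p T) = moment alpha q (p T')]].

End Space.

Arguments space3 : clear implicits.
Arguments box : clear implicits.

(* Main.v *)
(* A polynomial of degree at most k in one variable is determined by its values
   and first derivatives at two points and its moments of order < k - 3: if they
   all vanish it is (t - a)^2 (t - b)^2 q, and the moment against q forces q = 0.
   Each degree of freedom is a tensor product of such functionals, one per axis.
   If those attached to an entity G of a cell and to the sub-entities of G vanish
   at u, then slot by slot so do the tensor products with arbitrary functionals
   along the axes parallel to G, hence all d^alpha u, alpha in {0,1}^3, vanish on
   G. For G = T this gives u = 0, and unisolvence follows from the count
   ((k - 3) + 2 + 2)^3 = (k + 1)^3. For G the common entity of two cells, it shows
   that the pieces of a finite element function and all their first derivatives
   agree on G.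
   A function with pieces agreeing on common entities can be integrated by parts
   against a test function phi along every line parallel to an axis: between two
   consecutive coordinates of cell faces, the line stays in a single cell, or
   outside Omega where phi vanishes, and the boundary terms telescope. Fubini and
   two applications give the weak derivatives up to order 2. *)
Require Import Defs.
From HB Require Import structures.
From mathcomp Require Import all_boot all_order all_algebra.
From mathcomp Require Import all_classical all_reals all_analysis.
From mathcomp Require Import measurable_realfun ring lra zify.
Import Defs.

Import Order.TTheory GRing.Theory Num.Theory.
Import numFieldNormedType.Exports.

Local Open Scope classical_set_scope.
Local Open Scope ring_scope.

(** * Coordinates *)

Section Coordinates.
Context {R : realType}.
Implicit Types (x y v : space3 R) (i : 'I_3).

(** Case analysis in the [inord] form that the definitions of derivatives and boxes use for the
    axes. *)
Lemma ord3P (P : 'I_3 -> Prop) :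
  P (inord 0) -> P (inord 1) -> P (inord 2) -> forall i, P i.
Proof.
move=> P0 P1 P2 [[|[|[|//]]] i3].
- by rewrite (_ : Ordinal i3 = inord 0)//; apply/val_inj; rewrite /= inordK.
- by rewrite (_ : Ordinal i3 = inord 1)//; apply/val_inj; rewrite /= inordK.
- by rewrite (_ : Ordinal i3 = inord 2)//; apply/val_inj; rewrite /= inordK.
Qed.

Lemma coord0 x : coord x (inord 0) = x.1.1.
Proof. by rewrite /coord /= inordK. Qed.

Lemma coord1 x : coord x (inord 1) = x.1.2.
Proof. by rewrite /coord /= inordK. Qed.

Lemma coord2 x : coord x (inord 2) = x.2.
Proof. by rewrite /coord /= inordK. Qed.

Lemma inord3_eq (m n : nat) : (m < 3)%N -> (n < 3)%N ->
  ((inord m : 'I_3) == inord n) = (m == n).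
Proof.
move=> m3 n3; apply/eqP/eqP => [|->//].
by move=> /(congr1 val); rewrite /= !inordK.
Qed.

Lemma coord_mkspace3 (f : 'I_3 -> R) i : coord (mkspace3 f) i = f i.
Proof. by move: i; apply: ord3P; rewrite ?(coord0, coord1, coord2). Qed.

Lemma coordD x y i : coord (x + y) i = coord x i + coord y i.
Proof. by move: i; apply: ord3P; rewrite ?(coord0, coord1, coord2). Qed.

Lemma coordZ (t : R) x i : coord (t *: x) i = t * coord x i.
Proof. by move: i; apply: ord3P; rewrite ?(coord0, coord1, coord2). Qed.

Lemma coord_basis i j : coord (basis_vector i : space3 R) j = (j == i)%:R.
Proof. by rewrite /basis_vector coord_mkspace3. Qed.

Lemma coord_inj x y : (forall i, coord x i = coord y i) -> x = y.
Proof.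
case: x => [[a b] c]; case: y => [[a' b'] c'] H.
have := H (inord 0); have := H (inord 1); have := H (inord 2).
by rewrite !(coord0, coord1, coord2) /= => -> -> ->.
Qed.

Lemma continuous_coord i : continuous (fun x : space3 R => coord x i).
Proof.
have c1 : continuous (fun x : space3 R => x.1.1).
  by move=> x; apply: (@continuous_comp _ _ _ fst fst); exact: cvg_fst.
have c2 : continuous (fun x : space3 R => x.1.2).
  by move=> x; apply: (@continuous_comp _ _ _ fst snd); [exact: cvg_fst|exact: cvg_snd].
have c3 : continuous (fun x : space3 R => x.2).
  by move=> x; exact: cvg_snd.
move: i; apply: ord3P.
- by under eq_fun do rewrite coord0.
- by under eq_fun do rewrite coord1.
- by under eq_fun do rewrite coord2.
Qed.

Lemma is_derive_coord x v i :
  is_derive x v (fun y : space3 R => coord y i : R^o) (coord v i).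
Proof.
have H : (fun h : R => h^-1 *: ((coord (h *: v + x) i : R^o) - coord x i))
    @ 0^' --> (coord v i : R^o).
  (* The difference quotient of a coordinate is constant away from h = 0. *)
  apply: (@cvg_trans _ ((cst (coord v i : R^o) : R -> R^o) @ 0^')); last first.
    exact: cvg_cst.
  apply: near_eq_cvg; near=> h; rewrite /cst coordD coordZ addrK.
  rewrite /GRing.scale /= mulrA mulVf ?mul1r//.
  by near: h; exact: nbhs_dnbhs_neq.
by apply: DeriveDef; [apply/cvg_ex; exists (coord v i); exact: H|exact: cvg_lim H].
Unshelve. all: by end_near. Qed.

End Coordinates.

(** * Polynomials as lists of monomials *)

Section Monomials.
Context {R : realType}.

(* A coefficient and the exponents of x_1, x_2, x_3. Lists of monomials, unlike
   Qpoly a b c, form a single type closed under differentiation. *)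
Definition monomial : Type := (R * (nat * nat * nat))%type.

Definition monoms (s : seq monomial) (x : space3 R) : R :=
  \sum_(m <- s) m.1 * (x.1.1 ^+ m.2.1.1 * x.1.2 ^+ m.2.1.2 * x.2 ^+ m.2.2).

Definition dmonomial (i : 'I_3) (m : monomial) : monomial :=
  let: (c, (e0, e1, e2)) := m in
  if i == inord 0 then (c * e0%:R, (e0.-1, e1, e2))
  else if i == inord 1 then (c * e1%:R, (e0, e1.-1, e2))
  else (c * e2%:R, (e0, e1, e2.-1)).

Lemma is_derive_coordX (i j : 'I_3) (n : nat) (x : space3 R) :
  is_derive x (basis_vector i) (fun y => coord y j ^+ n : R^o)
    (n%:R * coord x j ^+ n.-1 * (j == i)%:R).
Proof.
have := @is_deriveX _ _ _ n _ _ _ (is_derive_coord x (basis_vector i) j).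
rewrite coord_basis; congr is_derive; apply/funext => y.
by rewrite exprfctE.
Qed.

Lemma is_derive_monoms (s : seq monomial) (i : 'I_3) (x : space3 R) :
  is_derive x (basis_vector i) (monoms s : _ -> R^o)
    (monoms [seq dmonomial i m | m <- s] x).
Proof.
rewrite /monoms big_map; elim: s => [|[c [[e0 e1] e2]] s IH].
  rewrite big_nil (_ : (fun _ => _) = cst 0); first exact: is_derive_cst.
  by apply/funext => y; rewrite big_nil.
rewrite big_cons.
have := is_deriveD (is_deriveZ c (is_deriveM (is_deriveM
  (is_derive_coordX i (inord 0) e0 x) (is_derive_coordX i (inord 1) e1 x))
  (is_derive_coordX i (inord 2) e2 x))) IH.
set F := (_ + _ : _ -> _) => H.
rewrite (_ : (fun _ => _) = F); last first.
  apply/funext => y; rewrite big_cons; congr (_ + _) => /=.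
  by rewrite -(coord0 y) -(coord1 y) -(coord2 y).
apply: (is_derive_eq H); congr (_ + _).
rewrite /dmonomial !fctE /GRing.scale /=.
move: i {IH F H}; apply: ord3P; rewrite !inord3_eq// !(coord0, coord1, coord2) /=; ring.
Qed.

Lemma partial_monoms (s : seq monomial) (i : 'I_3) :
  partial i (monoms s) = monoms [seq dmonomial i m | m <- s].
Proof.
apply/funext => x; have H := is_derive_monoms s i x.
by rewrite /partial derive_val.
Qed.

Lemma continuous_monoms (s : seq monomial) : continuous (monoms s).
Proof.
have cX i n : continuous (fun y : space3 R => coord y i ^+ n).
  move=> y; apply: (@continuous_comp _ _ _ (fun y => coord y i) (fun t : R => t ^+ n)).
    exact: continuous_coord.
  exact: exprn_continuous.
elim: s => [|[c [[e0 e1] e2]] s IH].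
  rewrite (_ : monoms _ = cst 0); first exact: cst_continuous.
  by apply/funext => y; rewrite /monoms big_nil.
rewrite (_ : monoms _ = fun y => c * (coord y (inord 0) ^+ e0 *
  coord y (inord 1) ^+ e1 * coord y (inord 2) ^+ e2) + monoms s y); last first.
  by apply/funext => y; rewrite /monoms big_cons !(coord0, coord1, coord2).
move=> y; apply: cvgD (IH y); apply: cvgMr.
by apply: cvgM; [apply: cvgM|]; exact: cX.
Qed.

(** Monomial lists are closed under [partial], so every iterated partial derivative is again a
    polynomial. *)
Lemma smooth_monoms (s : seq monomial) : smooth (monoms s).
Proof.
move=> t /=; suff [s' ->] : exists s', foldr partial (monoms s) t = monoms s'.
  split=> [|i x]; first exact: continuous_monoms.
  by have [] := is_derive_monoms s' i x.
elim: t => [|i t [s' IH]] /=; first by exists s.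
by rewrite IH partial_monoms; eexists.
Qed.

(* A linear functional on the polynomials in one variable is represented by its
   values n |-> l n on the powers t ^ n. *)
Definition tens (l0 l1 l2 : nat -> R) (s : seq monomial) : R :=
  \sum_(m <- s) m.1 * (l0 m.2.1.1 * l1 m.2.1.2 * l2 m.2.2).

(** As a function of [n], this represents evaluation at [t], or evaluation of the derivative at [t]
    when [o] holds. The factor [n%:R] neutralises the truncated predecessor at n = 0. *)
Definition dpow (o : bool) (t : R) (n : nat) : R :=
  if o then n%:R * t ^+ n.-1 else t ^+ n.

Lemma multi_partial_monoms (alpha : 'I_3 -> bool) (s : seq monomial) x :
  multi_partial (fun i => alpha i) (monoms s) x =
  tens (dpow (alpha (inord 0)) x.1.1) (dpow (alpha (inord 1)) x.1.2)
    (dpow (alpha (inord 2)) x.2) s.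
Proof.
rewrite /multi_partial.
case: (alpha (inord 0)); case: (alpha (inord 1)); case: (alpha (inord 2));
rewrite /= ?partial_monoms /monoms /tens ?big_map; apply: eq_bigr;
move=> [c [[e0 e1] e2]] _; rewrite /dmonomial /dpow ?inord3_eq //=; ring.
Qed.

Definition monoms_of {a b c : nat} (q : Qpoly (R := R) a b c) : seq monomial :=
  [seq ((q : {ffun 'I_a * 'I_b * 'I_c -> R^o}) e,
     (nat_of_ord e.1.1, nat_of_ord e.1.2, nat_of_ord e.2))
   | e : 'I_a * 'I_b * 'I_c].

Lemma tens_monoms_of (a b c : nat) (q : Qpoly a b c) l0 l1 l2 :
  tens l0 l1 l2 (monoms_of q) =
  \sum_(e : 'I_a * 'I_b * 'I_c) (q : {ffun 'I_a * 'I_b * 'I_c -> R^o}) e *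
    (l0 e.1.1 * l1 e.1.2 * l2 e.2).
Proof. by rewrite /tens /monoms_of big_map big_enum. Qed.

Lemma Qeval_monoms (a b c : nat) (q : Qpoly a b c) :
  Qeval q = monoms (monoms_of q).
Proof.
by apply/funext => x; rewrite /monoms /monoms_of big_map big_enum.
Qed.

Lemma smooth_Qeval (a b c : nat) (q : Qpoly (R := R) a b c) : smooth (Qeval q).
Proof. by rewrite Qeval_monoms; exact: smooth_monoms. Qed.

End Monomials.

(** * Hermite interpolation in one variable *)

Section Hermite.
Context {R : realType}.

Lemma continuous_integrable_itv (a b : R) (f : R -> R) : continuous f ->
  (@lebesgue_measure R).-integrable `[a, b] (EFin \o f).
Proof.
move=> cf; apply: continuous_compact_integrable; first exact: segment_compact.
exact: continuous_subspaceT.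
Qed.

Lemma int_axis_sum (I : Type) (r : seq I) (a b : R) (c : I -> R)
    (F : I -> R -> R) : (forall i, continuous (F i)) ->
  int_axis a b (fun t => \sum_(i <- r) c i * F i t) =
  \sum_(i <- r) c i * int_axis a b (F i).
Proof.
move=> cF; rewrite /int_axis; case: ifPn => // _.
have cS s : continuous (fun t => \sum_(i <- s) c i * F i t).
  elim: s => [|i s IH].
    by under eq_fun do rewrite big_nil; exact: cst_continuous.
  under eq_fun do rewrite big_cons.
  by move=> t; apply: cvgD (IH t); apply: cvgMr; exact: cF.
elim: r => [|i r IH].
  under eq_Rintegral do rewrite big_nil.
  by rewrite Rintegral_cst// mul0r big_nil.
under eq_Rintegral do rewrite big_cons.
have ci : continuous (fun t => c i * F i t) by move=> t; apply: cvgMr; exact: cF.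
rewrite RintegralD//; try exact: continuous_integrable_itv.
by rewrite IH big_cons RintegralZl//; exact: continuous_integrable_itv.
Qed.

(** A nonnegative function with zero integral vanishes almost everywhere. Were [p] nonzero, its
    finitely many roots would make [[a, b]] negligible, against b - a > 0. *)
Lemma horner_eq0_itv (p : {poly R}) (a b : R) : a < b ->
  (forall t, 0 <= p.[t]) -> \int[lebesgue_measure]_(t in `[a, b]) p.[t] = 0 ->
  p = 0.
Proof.
move=> ab p0 intp; apply/eqP; apply: contrapT => /negP pn0.
have cp : continuous (fun t => p.[t]) by exact: continuous_horner.
have ip := continuous_integrable_itv a b _ cp.
have : (\int[lebesgue_measure]_(t in `[a, b]) `|(EFin \o horner p) t| = 0)%E.
  under eq_integral do rewrite /= ger0_norm//.
  have /fineK <- : (\int[lebesgue_measure]_(t in `[a, b]) (p.[t])%:E)%E \is a fin_num.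
    by apply: integrable_fin_num ip.
  by congr EFin.
move/(ae_eq_integral_abs (@lebesgue_measure R)) => p_ae0.
have {}p_ae0 : ae_eq (@lebesgue_measure R) `[a, b]%classic (EFin \o horner p) (cst 0%E).
  by apply: p_ae0 => //; exact: measurable_int ip.
have root0 : (@lebesgue_measure R).-negligible [set t | root p t].
  have cr : countable [set t | root p t].
    (* An infinite root set would contain at least [size p] distinct roots, too many for a nonzero
       polynomial. *)
    apply: finite_set_countable; apply: contrapT.
    move=> /(@infinite_set_fset R _ (size p))[s sr]; apply/negP; rewrite -ltnNge.
    apply: max_poly_roots => //; last exact: finmap.fset_uniq.
    by apply/allP => t; exact: sr.
  apply/negligibleP; last exact: countable_lebesgue_measure0.
  by apply: countable_measurable cr => t; exact: measurable_set1.
have nab : (@lebesgue_measure R).-negligible `[a, b]%classic.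
  apply: negligibleS (negligibleU p_ae0 root0) => t abt /=.
  have [pt|/negP pt] := boolP (root p t); [by right|left => /=].
  by move=> /(_ abt)[/eqP].
have : lebesgue_measure `[a, b]%classic = 0%E by exact: measure_negligible.
rewrite lebesgue_measure_itv/= lte_fin ab.
by move=> /eqP; rewrite -EFinB eqe subr_eq0 gt_eqF.
Qed.



(** For a < b this is the moment against t^m of t^n or of its derivative. For a = b, [int_axis]
    evaluates at the point, so with m = 0 the same formula is [dpow o a]. One family thus covers
    both the axes parallel to an entity and those normal to it. *)
Definition hermite_functional (a b : R) (o : bool) (m n : nat) : R :=
  int_axis a b (fun t => dpow o t n * t ^+ m).

Lemma hermite_functional_pt (a : R) (o : bool) (n : nat) :
  hermite_functional a a o 0 n = dpow o a n.
Proof. by rewrite /hermite_functional /int_axis ltxx mulr1. Qed.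

Lemma double_root (p : {poly R}) (a : R) : p.[a] = 0 -> p^`().[a] = 0 ->
  exists q, p = q * ('X - a%:P) ^+ 2.
Proof.
move=> /eqP /factor_theorem[q ->].
rewrite derivM derivXsubC mulr1 hornerD hornerM hornerXsubC subrr mulr0 add0r.
by move=> /eqP /factor_theorem[q' ->]; exists q'; rewrite expr2 mulrA.
Qed.

Lemma hermite_unisolvent (k : nat) (a b : R) (c : nat -> R) :
  (3 <= k)%N -> a < b ->
  (forall o, \sum_(j < k.+1) c j * dpow o a j = 0) ->
  (forall o, \sum_(j < k.+1) c j * dpow o b j = 0) ->
  (forall m, (m < k - 3)%N ->
    \sum_(j < k.+1) c j * hermite_functional a b false m j = 0) ->
  forall j, (j < k.+1)%N -> c j = 0.
Proof.
move=> k3 ab ca cb cm.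
pose p := \poly_(j < k.+1) c j.
have pE t : p.[t] = \sum_(j < k.+1) c j * dpow false t j by rewrite horner_poly.
have dpE t : p^`().[t] = \sum_(j < k.+1) c j * dpow true t j.
  rewrite /p poly_def linear_sum /= horner_sum; apply: eq_bigr => j _.
  by rewrite derivZ derivXn hornerZ hornerMn hornerXn /= mulr_natl.
suff p0 : p = 0 by move=> j jk; move: (congr1 (fun q : {poly R} => q`_j) p0);
  rewrite coef_poly jk coef0.
have [q1 pq1] : exists q, p = q * ('X - a%:P) ^+ 2.
  by apply: double_root; rewrite ?pE ?dpE.
have ba0 : b - a != 0 by rewrite subr_eq0 gt_eqF.
have [q pq] : exists q, p = q * ('X - b%:P) ^+ 2 * ('X - a%:P) ^+ 2.
  (* The factor (b - a)^2 is nonzero, so it cancels from p(b) = 0, and then from p'(b) = q1'(b) (b -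
     a)^2 = 0. *)
  have q1b : q1.[b] = 0.
    move: (pE b); rewrite cb pq1 hornerM horner_exp hornerXsubC => /eqP.
    by rewrite mulf_eq0 expf_eq0 /= (negPf ba0) orbF => /eqP.
  have dq1b : q1^`().[b] = 0.
    move: (dpE b); rewrite cb pq1 derivM hornerD !hornerM q1b mul0r addr0.
    rewrite !hornerXsubC => /eqP.
    by rewrite !mulf_eq0 (negPf ba0) !orbF => /eqP.
  by have [q q1E] := double_root _ _ q1b dq1b; exists q; rewrite pq1 q1E.
have [q0|q0] := eqVneq q 0; first by rewrite pq q0 !mul0r.
(* The size is the degree plus one: [p] has size at most k + 1 and the two squares account for
   degree 4. *)
have szq : (size q <= k - 3)%N.
  have := size_poly k.+1 c; rewrite -/p pq -mulrA size_mul//; last first.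
    by rewrite mulf_neq0// expf_neq0// polyXsubC_eq0.
  rewrite size_mul ?expf_neq0 ?polyXsubC_eq0// !size_exp_XsubC /=.
  by move: (size _) => n; lia.
(* Expanded in the monomials of [q], the integral is a combination of moments of [p] of order below
   k - 3. *)
have intpq : \int[lebesgue_measure]_(t in `[a, b]) (p * q).[t] = 0.
  have : int_axis a b (fun t => \sum_(m < size q) q`_m * (p.[t] * t ^+ m)) = 0.
    rewrite int_axis_sum; last first.
      move=> m t; apply: cvgM; first exact: continuous_horner.
      exact: exprn_continuous.
    rewrite big1// => m _; rewrite [X in _ * X](_ : _ = 0) ?mulr0//.
    rewrite -(cm m (leq_trans (ltn_ord m) szq)) /hermite_functional -int_axis_sum.
      congr int_axis; apply/funext => t; rewrite pE mulr_suml.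
      by apply: eq_bigr => j _; rewrite mulrA.
    by move=> j t; apply: cvgM; exact: exprn_continuous.
  rewrite /int_axis ab => <-; apply: eq_Rintegral => t _.
  rewrite hornerM [q.[t]]horner_coef mulr_sumr; apply: eq_bigr => m _.
  by rewrite mulrCA.
have : p * q = 0.
  apply: (horner_eq0_itv _ a b) => // t.
  have -> : p * q = (q * ('X - b%:P) * ('X - a%:P)) ^+ 2 by rewrite pq; ring.
  by rewrite horner_exp sqr_ge0.
by move=> /eqP; rewrite mulf_eq0 (negPf q0) orbF => /eqP.
Qed.

End Hermite.

(** * Degrees of freedom as tensor products *)

Section Tensor.
Context {R : realType}.
Implicit Types (T G : box R) (s : 'I_3 -> option bool).

(** With [l1] and [l2] fixed, the tensor product is [l0] applied to a polynomial in one variable.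
    Its coefficient of index [j] is found by putting in the first slot the functional that extracts
    the coefficient of t^j. *)
Lemma tens_slot0 (l0 l1 l2 : nat -> R) (ms : seq monomial) (n : nat) :
  all (fun m => m.2.1.1 < n)%N ms ->
  tens l0 l1 l2 ms =
  \sum_(j < n) tens (fun e => (e == j)%:R) l1 l2 ms * l0 j.
Proof.
move=> /allP msn; rewrite /tens; under [RHS]eq_bigr do rewrite mulr_suml.
rewrite exchange_big /= !big_seq; apply: eq_bigr => m /msn mn.
rewrite (bigD1 (Ordinal mn))//= big1 => [|j /negPf jm]; first by rewrite /= eqxx /=; ring.
by rewrite eq_sym -val_eqE /= in jm; rewrite jm !mul0r mulr0 mul0r.
Qed.

Lemma tens_slot1 (l0 l1 l2 : nat -> R) (ms : seq monomial) (n : nat) :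
  all (fun m => m.2.1.2 < n)%N ms ->
  tens l0 l1 l2 ms =
  \sum_(j < n) tens l0 (fun e => (e == j)%:R) l2 ms * l1 j.
Proof.
move=> /allP msn; rewrite /tens; under [RHS]eq_bigr do rewrite mulr_suml.
rewrite exchange_big /= !big_seq; apply: eq_bigr => m /msn mn.
rewrite (bigD1 (Ordinal mn))//= big1 => [|j /negPf jm]; first by rewrite /= eqxx /=; ring.
by rewrite eq_sym -val_eqE /= in jm; rewrite jm mulr0 !mul0r mulr0 mul0r.
Qed.

Lemma tens_slot2 (l0 l1 l2 : nat -> R) (ms : seq monomial) (n : nat) :
  all (fun m => m.2.2 < n)%N ms ->
  tens l0 l1 l2 ms =
  \sum_(j < n) tens l0 l1 (fun e => (e == j)%:R) ms * l2 j.
Proof.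
move=> /allP msn; rewrite /tens; under [RHS]eq_bigr do rewrite mulr_suml.
rewrite exchange_big /= !big_seq; apply: eq_bigr => m /msn mn.
rewrite (bigD1 (Ordinal mn))//= big1 => [|j /negPf jm]; first by rewrite /= eqxx /=; ring.
by rewrite eq_sym -val_eqE /= in jm; rewrite jm !mulr0 mul0r.
Qed.

Definition hermite_set (k : nat) (a b : R) : set (nat -> R) :=
  [set l | (exists o, l = dpow o a) \/ (exists o, l = dpow o b) \/
    exists2 m, (m < k - 3)%N & l = hermite_functional a b false m].

Lemma hermite_set_total (k : nat) (a b : R) (c : nat -> R) :
  (3 <= k)%N -> a < b ->
  (forall l, hermite_set k a b l -> \sum_(j < k.+1) c j * l j = 0) ->
  forall l, \sum_(j < k.+1) c j * l j = 0.
Proof.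
move=> k3 ab cl l; apply: big1 => j _.
rewrite (hermite_unisolvent k a b c k3 ab) ?mul0r//.
- by move=> o; apply: cl; left; exists o.
- by move=> o; apply: cl; right; left; exists o.
- by move=> m mk; apply: cl; right; right; exists m.
Qed.

(* The functionals of the degrees of freedom in the direction of one axis: the
   box is the interval [a, b] (None) or one of its ends (Some c) there. *)
Definition axis_set (k : nat) (a b : R) (o : option bool) : set (nat -> R) :=
  if o is Some c then [set l | exists d, l = dpow d (if c then b else a)]
  else hermite_set k a b.

(** The functionals controlled by [axis_set]: all of them on a whole interval, since the Hermite
    data determine the polynomial, but only value and derivative at an end. *)
Definition axis_span (a b : R) (o : option bool) : set (nat -> R) :=
  if o is Some c then [set l | exists d, l = dpow d (if c then b else a)]
  else setT.

Lemma axis_set_span (k : nat) (a b : R) o (c : nat -> R) :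
  (3 <= k)%N -> a < b ->
  (forall l, axis_set k a b o l -> \sum_(j < k.+1) c j * l j = 0) ->
  forall l, axis_span a b o l -> \sum_(j < k.+1) c j * l j = 0.
Proof.
move=> k3 ab; case: o => [d|] cl l; first exact: cl.
by move=> _; exact: (hermite_set_total _ _ _ _ k3 ab cl).
Qed.

(** The axes are enlarged one after another: with two slots fixed, the third sees a polynomial in
    one variable, to which [axis_set_span] applies. *)
Lemma tens_span (k : nat) (T : box R) (s : 'I_3 -> option bool)
    (ms : seq monomial) : (3 <= k)%N -> cuboid T ->
  all (fun m => [&& m.2.1.1 < k.+1, m.2.1.2 < k.+1 & m.2.2 < k.+1]%N) ms ->
  let A i := axis_set k (lo T i) (hi T i) (s i) in
  let S i := axis_span (lo T i) (hi T i) (s i) in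
  (forall l0 l1 l2, A (inord 0) l0 -> A (inord 1) l1 -> A (inord 2) l2 ->
    tens l0 l1 l2 ms = 0) ->
  forall l0 l1 l2, S (inord 0) l0 -> S (inord 1) l1 -> S (inord 2) l2 ->
    tens l0 l1 l2 ms = 0.
Proof.
move=> k3 cT msk A S H.
have a0 : all (fun m => m.2.1.1 < k.+1)%N ms.
  by apply: sub_all msk => m /and3P[].
have a1 : all (fun m => m.2.1.2 < k.+1)%N ms.
  by apply: sub_all msk => m /and3P[].
have a2 : all (fun m => m.2.2 < k.+1)%N ms.
  by apply: sub_all msk => m /and3P[].
have H0 l0 l1 l2 : S (inord 0) l0 -> A (inord 1) l1 -> A (inord 2) l2 ->
    tens l0 l1 l2 ms = 0.
  move=> Sl0 Al1 Al2; rewrite (tens_slot0 _ _ _ _ _ a0).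
  apply: (axis_set_span _ _ _ _ (fun j => tens (fun e => (e == j)%:R) l1 l2 ms)
    k3 (cT (inord 0)) _ _ Sl0) => l Al.
  by rewrite -tens_slot0//; exact: H.
have H1 l0 l1 l2 : S (inord 0) l0 -> S (inord 1) l1 -> A (inord 2) l2 ->
    tens l0 l1 l2 ms = 0.
  move=> Sl0 Sl1 Al2; rewrite (tens_slot1 _ _ _ _ _ a1).
  apply: (axis_set_span _ _ _ _ (fun j => tens l0 (fun e => (e == j)%:R) l2 ms)
    k3 (cT (inord 1)) _ _ Sl1) => l Al.
  by rewrite -tens_slot1//; exact: H0.
move=> l0 l1 l2 Sl0 Sl1 Sl2; rewrite (tens_slot2 _ _ _ _ _ a2).
apply: (axis_set_span _ _ _ _ (fun j => tens l0 l1 (fun e => (e == j)%:R) ms)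
    k3 (cT (inord 2)) _ _ Sl2) => l Al.
by rewrite -tens_slot2//; exact: H1.
Qed.

Lemma monoms_of_lt (a b c : nat) (q : Qpoly (R := R) a b c) :
  all (fun m => [&& m.2.1.1 < a, m.2.1.2 < b & m.2.2 < c]%N) (monoms_of q).
Proof.
by apply/allP => m /mapP[[[i j] l] _ ->] /=; rewrite !ltn_ord.
Qed.

Lemma lo_sub_box T s i :
  lo (sub_box T s) i = if s i is Some true then hi T i else lo T i.
Proof. by rewrite /lo /sub_box /= coord_mkspace3. Qed.

Lemma hi_sub_box T s i :
  hi (sub_box T s) i = if s i is Some false then lo T i else hi T i.
Proof. by rewrite /hi /sub_box /= coord_mkspace3. Qed.

Lemma parallel_sub_box T s i : cuboid T ->
  parallel (sub_box T s) i = (s i == None).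
Proof.
move=> cT; rewrite /parallel lo_sub_box hi_sub_box.
by case: (s i) => [[]|]; rewrite ?ltxx//; exact: cT.
Qed.

(** The integral over a box is iterated by definition, so products separate from the innermost axis
    outwards, flat axes included. *)
Lemma int_box_tens (I : Type) (r : seq I) G (c : I -> R) (F0 F1 F2 : I -> R -> R) :
  (forall i, continuous (F0 i)) -> (forall i, continuous (F1 i)) ->
  (forall i, continuous (F2 i)) ->
  int_box G (fun x => \sum_(i <- r) c i * (F0 i x.1.1 * F1 i x.1.2 * F2 i x.2)) =
  \sum_(i <- r) c i * (int_axis (lo G (inord 0)) (hi G (inord 0)) (F0 i) *
    int_axis (lo G (inord 1)) (hi G (inord 1)) (F1 i) *
    int_axis (lo G (inord 2)) (hi G (inord 2)) (F2 i)).
Proof.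
move=> c0 c1 c2; rewrite /int_box.
pose I2 i := int_axis (lo G (inord 2)) (hi G (inord 2)) (F2 i).
pose I1 i := int_axis (lo G (inord 1)) (hi G (inord 1)) (F1 i).
transitivity (int_axis (lo G (inord 0)) (hi G (inord 0)) (fun x1 =>
    int_axis (lo G (inord 1)) (hi G (inord 1)) (fun x2 =>
      \sum_(i <- r) c i * F0 i x1 * I2 i * F1 i x2))).
  congr int_axis; apply/funext => x1; congr int_axis; apply/funext => x2 /=.
  transitivity (int_axis (lo G (inord 2)) (hi G (inord 2)) (fun x3 =>
     \sum_(i <- r) (c i * F0 i x1 * F1 i x2) * F2 i x3)).
    by congr int_axis; apply/funext => x3; apply: eq_bigr => i _; ring.
  by rewrite int_axis_sum//; apply: eq_bigr => i _; rewrite /I2; ring.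
transitivity (int_axis (lo G (inord 0)) (hi G (inord 0)) (fun x1 =>
      \sum_(i <- r) c i * I1 i * I2 i * F0 i x1)).
  congr int_axis; apply/funext => x1.
  by rewrite int_axis_sum//; apply: eq_bigr => i _; rewrite /I1; ring.
by rewrite int_axis_sum//; apply: eq_bigr => i _; rewrite /I1 /I2; ring.
Qed.

Lemma continuous_dpow (o : bool) (n m : nat) :
  continuous (fun t : R => dpow o t n * t ^+ m).
Proof.
move=> t; apply: cvgM; last exact: exprn_continuous.
case: o; last exact: exprn_continuous.
by apply: cvgMr; exact: exprn_continuous.
Qed.

(** Both the test polynomial and [u] are expanded in monomials; each pair of monomials contributes a
    product of three integrals over an axis. *)
Lemma moment_tens (k : nat) G (alpha : order01) (q : moment_space k G)
    (u : shape_space k) :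
  let h i := hermite_functional (lo G i) (hi G i) (alpha i) in
  moment alpha q u = \sum_(m <- monoms_of (q : Qpoly _ _ _)) m.1 *
    tens (h (inord 0) m.2.1.1) (h (inord 1) m.2.1.2) (h (inord 2) m.2.2)
      (monoms_of (u : Qpoly _ _ _)).
Proof.
move=> h; rewrite /moment /moment_eval !Qeval_monoms.
under [in LHS]eq_fun do rewrite multi_partial_monoms.
pose r := [seq (m, m') | m <- monoms_of (q : Qpoly _ _ _),
                         m' <- monoms_of (u : Qpoly _ _ _)].
transitivity (int_box G (fun x => \sum_(p <- r) p.1.1 * p.2.1 *
  ((dpow (alpha (inord 0)) x.1.1 p.2.2.1.1 * x.1.1 ^+ p.1.2.1.1) *
   (dpow (alpha (inord 1)) x.1.2 p.2.2.1.2 * x.1.2 ^+ p.1.2.1.2) *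
   (dpow (alpha (inord 2)) x.2 p.2.2.2 * x.2 ^+ p.1.2.2)))).
  congr int_box; apply/funext => x; rewrite /r big_allpairs /tens /monoms.
  rewrite mulr_sumr; apply: eq_bigr => m _; rewrite mulr_suml.
  by apply: eq_bigr => m' _ /=; ring.
pose c (p : @monomial R * @monomial R) : R := p.1.1 * p.2.1.
pose F0 (p : @monomial R * @monomial R) t : R :=
  dpow (alpha (inord 0)) t p.2.2.1.1 * t ^+ p.1.2.1.1.
pose F1 (p : @monomial R * @monomial R) t : R :=
  dpow (alpha (inord 1)) t p.2.2.1.2 * t ^+ p.1.2.1.2.
pose F2 (p : @monomial R * @monomial R) t : R :=
  dpow (alpha (inord 2)) t p.2.2.2 * t ^+ p.1.2.2.
rewrite (int_box_tens _ r G c F0 F1 F2); try by move=> p; exact: continuous_dpow.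
rewrite /r big_allpairs; apply: eq_bigr => m _; rewrite /tens mulr_sumr.
by apply: eq_bigr => m' _; rewrite [RHS]mulrA.
Qed.

End Tensor.

(** * From vanishing degrees of freedom to vanishing derivatives on an entity *)

Section Vanishing.
Context {R : realType}.
Implicit Types (T G : box R) (s : 'I_3 -> option bool).

Definition pick3 {A : Type} (a b c : A) (i : 'I_3) : A :=
  if i == inord 0 then a else if i == inord 1 then b else c.

Lemma pick30 {A : Type} (a b c : A) : pick3 a b c (inord 0) = a.
Proof. by rewrite /pick3 eqxx. Qed.

Lemma pick31 {A : Type} (a b c : A) : pick3 a b c (inord 1) = b.
Proof. by rewrite /pick3 inord3_eq// eqxx. Qed.

Lemma pick32 {A : Type} (a b c : A) : pick3 a b c (inord 2) = c.
Proof. by rewrite /pick3 !inord3_eq. Qed.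

Definition pick3E := (@pick30, @pick31, @pick32).

(** The test polynomial consisting of the single monomial with exponents [m] isolates one tensor
    product. *)
Lemma moment_eq0_tens (k : nat) G (alpha : order01) (u : shape_space k) :
  (forall q : moment_space k G, moment alpha q u = 0) ->
  forall m : 'I_3 -> nat,
  (forall i, m i < if parallel G i then k - 3 else 1)%N ->
  let h i := hermite_functional (lo G i) (hi G i) (alpha i) (m i) in
  tens (h (inord 0)) (h (inord 1)) (h (inord 2))
    (monoms_of (u : Qpoly _ _ _)) = 0.
Proof.
move=> H m mG h.
pose e0 := (Ordinal (mG (inord 0)), Ordinal (mG (inord 1)), Ordinal (mG (inord 2))).
pose q : moment_space k G := [ffun e => (e == e0)%:R].
have := H q; rewrite moment_tens; move: (monoms_of (u : Qpoly _ _ _)) => U.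
rewrite /monoms_of big_map big_enum/= (bigD1 e0)//= big1 ?addr0; last first.
  by move=> e /negPf ee0; rewrite ffunE ee0 mul0r.
by rewrite ffunE eqxx mul1r.
Qed.

(** Assigns a functional of one axis to the part [o'] of the axis that carries it. A moment stays on
    the whole interval and involves no derivative; a value or derivative at an end belongs to that
    end, as a moment of order 0 over a point. *)
Lemma axis_set_functional (k : nat) (a b : R) o (l : nat -> R) :
  axis_set k a b o l ->
  exists o' d m, [/\ o = None \/ o' = o, o' = None -> d = false,
    (m < if o' == None then k - 3 else 1)%N &
    l = hermite_functional (if o' is Some true then b else a)
          (if o' is Some false then a else b) d m].
Proof.
have E (c : bool) d : dpow d (if c then b else a) = hermite_functional
    (if Some c is Some true then b else a)
    (if Some c is Some false then a else b) d 0.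
  by apply/funext => n; case: c; rewrite hermite_functional_pt.
case: o => [c [d ->]|]; first by exists (Some c), d, 0%N; split=> //; right.
case=> [[d ->]|[[d ->]|[m mk ->]]].
- by exists (Some false), d, 0%N; split=> //; [left|exact: (E false)].
- by exists (Some true), d, 0%N; split=> //; [left|exact: (E true)].
- by exists None, false, m; split=> //; left.
Qed.

Lemma vertex_dof_tens (k : nat) T s (alpha : order01) (u : shape_space k) :
  let G := sub_box T s in
  vertex_dof G.1 alpha u = tens (dpow (alpha (inord 0)) (lo G (inord 0)))
    (dpow (alpha (inord 1)) (lo G (inord 1)))
    (dpow (alpha (inord 2)) (lo G (inord 2))) (monoms_of (u : Qpoly _ _ _)).
Proof.
by rewrite /vertex_dof Qeval_monoms multi_partial_monoms /lo coord0 coord1 coord2.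
Qed.

(** One functional per axis selects a sub-entity [s'] of [sub_box T s], and their tensor product is
    a degree of freedom attached to [s']. [tens_span] then passes to all functionals along the free
    axes. *)
Lemma dofs_eq0_tens (k : nat) T s (u : shape_space k) :
  (3 <= k)%N -> cuboid T ->
  (forall s' (alpha : order01), (forall i, s i = None \/ s' i = s i) ->
    (forall i, s' i <> None) -> vertex_dof (sub_box T s').1 alpha u = 0) ->
  (forall s' (alpha : order01), (forall i, s i = None \/ s' i = s i) ->
    (exists i, s' i = None) -> normal_to (sub_box T s') alpha ->
    forall q : moment_space k (sub_box T s'), moment alpha q u = 0) ->
  let A i := axis_span (lo T i) (hi T i) (s i) in
  forall l0 l1 l2, A (inord 0) l0 -> A (inord 1) l1 -> A (inord 2) l2 ->
  tens l0 l1 l2 (monoms_of (u : Qpoly _ _ _)) = 0.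
Proof.
move=> k3 cT Hv Hm.
apply: (tens_span k T s (monoms_of (u : Qpoly _ _ _)) k3 cT).
  exact: monoms_of_lt.
move=> l0 l1 l2 /axis_set_functional [p0 [d0 [m0 [s0 n0 mk0 ->]]]].
move=> /axis_set_functional [p1 [d1 [m1 [s1 n1 mk1 ->]]]].
move=> /axis_set_functional [p2 [d2 [m2 [s2 n2 mk2 ->]]]].
pose s' := pick3 p0 p1 p2.
pose alpha : order01 := [ffun i => pick3 d0 d1 d2 i].
have ss' i : s i = None \/ s' i = s i.
  by move: i; apply: ord3P; rewrite /s' pick3E.
have loE i : lo (sub_box T s') i = if s' i is Some true then hi T i else lo T i.
  exact: lo_sub_box.
have hiE i : hi (sub_box T s') i = if s' i is Some false then lo T i else hi T i.
  exact: hi_sub_box.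
(* Without a free axis [s'] is a vertex and the product is a vertex value; otherwise it is a
   moment. *)
have [sN|/existsNP[i0 /contrapT si0]] := pselect (forall i, s' i <> None).
  have := Hv s' alpha ss' sN; rewrite vertex_dof_tens !loE /alpha !ffunE /s'.
  rewrite !pick3E; have := (sN (inord 0), sN (inord 1), sN (inord 2)).
  rewrite /s' !pick3E; move: mk0 mk1 mk2 {s0 s1 s2 n0 n1 n2 ss' loE hiE sN s' Hv Hm}.
  case: p0 => [c0|]; last by move=> _ _ _ [] [].
  case: p1 => [c1|]; last by move=> _ _ _ [] [].
  case: p2 => [c2|]; last by move=> _ _ _ [] [].
  rewrite !ltnS !leqn0 => /eqP-> /eqP-> /eqP-> _ <-.
  by congr (tens _ _ _ _); apply/funext => n; rewrite hermite_functional_pt.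
have nor : normal_to (sub_box T s') alpha.
  apply/forallP => i; apply/implyP; rewrite parallel_sub_box// /alpha ffunE.
  by move: i {i0 si0}; apply: ord3P; rewrite /s' !pick3E => /eqP;
    [move/n0|move/n1|move/n2] => ->.
have := moment_eq0_tens k _ alpha u (Hm s' alpha ss' (ex_intro _ i0 si0) nor)
  (pick3 m0 m1 m2).
rewrite /= !loE !hiE /alpha !ffunE /s' !pick3E => -> // i.
by rewrite parallel_sub_box//; move: i {i0 si0}; apply: ord3P; rewrite /s' !pick3E.
Qed.

(** Along a fixed axis the coordinate of [x] is the chosen end of the interval, and along a free
    axis every functional is allowed, so the derivative at [x] is one of the vanishing tensor
    products. *)
Lemma multi_partial_eq0 (k : nat) T s (u : shape_space k) : cuboid T ->
  (let A i := axis_span (lo T i) (hi T i) (s i) in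
   forall l0 l1 l2, A (inord 0) l0 -> A (inord 1) l1 -> A (inord 2) l2 ->
   tens l0 l1 l2 (monoms_of (u : Qpoly _ _ _)) = 0) ->
  forall x (alpha : 'I_3 -> bool), box_set (sub_box T s) x ->
  multi_partial (fun i => alpha i) (Qeval u) x = 0.
Proof.
move=> cT H x alpha xs; rewrite Qeval_monoms multi_partial_monoms.
have A i : axis_span (lo T i) (hi T i) (s i) (dpow (alpha i) (coord x i)).
  move: (xs i); rewrite lo_sub_box hi_sub_box /axis_span.
  by case: (s i) => [[]|//]; move=> /le_anti <-; exists (alpha i).
by rewrite -coord0 -coord1 -coord2; apply: H.
Qed.

(** Extraction of a single coefficient is itself a tensor product of three functionals. *)
Lemma shape_eq0 (k : nat) (u : shape_space k) :
  (forall l0 l1 l2, tens l0 l1 l2 (monoms_of (u : Qpoly (R := R) _ _ _)) = 0) ->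
  u = 0.
Proof.
move=> H; apply/ffunP => e; rewrite [RHS]ffunE.
have := H (fun j => (j == e.1.1)%:R) (fun j => (j == e.1.2)%:R) (fun j => (j == e.2)%:R).
rewrite tens_monoms_of (bigD1 e)//= !eqxx !mulr1 big1 ?addr0// => f fe.
case: eqVneq => [e0|]; last by rewrite !mul0r mulr0.
case: eqVneq => [e1|]; last by rewrite mulr0 mul0r mulr0.
case: eqVneq => [e2|]; last by rewrite !mulr0.
case/negP: fe; apply/eqP; move: e0 e1 e2; case: e {H} => [[a b] c].
by case: f => [[a' b'] c'] /= /val_inj -> /val_inj -> /val_inj ->.
Qed.

End Vanishing.

(** * Unisolvence *)

Section DualBasis.
Context {K : fieldType} {V : vectType K}.

(* Evaluation at all functionals is an injective map between spaces of the same
   dimension, so the coordinate vectors have preimages, which separate the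
   functionals. *)
Lemma basis_of_dual (L : seq (V -> K^o)) : (forall l, l \in L -> linear l) ->
  size L = \dim {: V} ->
  (forall u, (forall l, l \in L -> l u = 0) -> u = 0) ->
  basis_of {: 'Hom(V, K^o)} [seq linfun l | l <- L].
Proof.
move=> linL szL ker0; set n := size L in szL.
have L_i (i : 'I_n) : nth (fun=> 0) L i \in L by exact: mem_nth.
pose ev (u : V) : 'rV[K]_n := \row_i nth (fun=> 0) L i u.
have ev_linear : linear ev.
  by move=> a u v; apply/rowP => i; rewrite !mxE (linL _ (L_i i)).
pose evL : {linear V -> 'rV[K]_n} := HB.pack ev (GRing.isLinear.Build _ _ _ _ ev ev_linear).
have lfE l u : l \in L -> linfun l u = l u.
  move=> lL; pose l' : {linear V -> K^o} :=
    HB.pack l (GRing.isLinear.Build _ _ _ _ l (linL _ lL)).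
  exact: (lfunE l').
have kerE : lker (linfun evL) == 0%VS.
  rewrite -subv0; apply/subvP => u; rewrite memv_ker lfunE => /eqP /rowP evu.
  rewrite memv0; apply/eqP/ker0 => l lL.
  have il : (index l L < n)%N by rewrite index_mem.
  by have := evu (Ordinal il); rewrite !mxE /= nth_index.
have surj w : exists v, ev v = w.
  have : w \in limg (linfun evL).
    suff -> : limg (linfun evL) = fullv by exact: memvf.
    apply/eqP; rewrite -dimv_leqif_eq ?subvf//.
    by rewrite limg_dim_eq ?(eqP kerE) ?capv0// -szL [\dim _]dimvf dim_matrix mul1r.
  by case/memv_imgP => v _ ->; exists v; rewrite lfunE.
have dimHom : \dim {: 'Hom(V, K^o)} = n by rewrite szL !dimvf; exact: muln1.
rewrite basisEfree subvf size_map dimHom leqnn !andbT.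
suff fL (c : 'I_n -> K) : \sum_(i < n) c i *: linfun (nth (fun=> 0) L i) = 0 ->
    forall i, c i = 0.
  rewrite (_ : [seq _ | _ <- _] = in_tuple [seq linfun l | l <- L])//.
  apply/freeP => /=; rewrite size_map => c c0 i; apply: fL.
  rewrite -[RHS]c0; apply: eq_bigr => j _.
  by rewrite (nth_map (fun=> 0)).
move=> c0 i; have [v vi] := surj (delta_mx 0 i).
move: (congr1 (fun f : 'Hom(V, K^o) => f v) c0).
rewrite sum_lfunE zero_lfunE (bigD1 i)//= big1 => [|j ji]; last first.
  rewrite scale_lfunE lfE//; move/rowP/(_ j): vi; rewrite !mxE eqxx /= => ->.
  by rewrite (negPf ji) scaler0.
rewrite addr0 scale_lfunE lfE//; move/rowP/(_ i): vi; rewrite !mxE !eqxx => ->.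
by rewrite /GRing.scale /= mulr1.
Qed.

End DualBasis.

(** * Counting the degrees of freedom *)

Section Counting.
Local Open Scope nat_scope.
Context {R : realType}.
Variables (k : nat) (T : box R).
Hypothesis cT : cuboid T.

Lemma dim_Qpoly (a b c : nat) : \dim {: Qpoly (R := R) a b c} = (a * b * c)%N.
Proof. by rewrite dimvf /dim /= muln1 !card_prod !card_ord. Qed.

Lemma sum_option_bool (F : option bool -> nat) :
  \sum_o F o = (F None + F (Some true) + F (Some false))%N.
Proof.
rewrite (bigD1 None)//= (bigD1 (Some true))//= (bigD1 (Some false))//= big1; last by case=> [[]|].
by rewrite addn0 addnA.
Qed.

Lemma prod_ord3 (F : 'I_3 -> nat) :
  (\prod_i F i = F (inord 0) * F (inord 1) * F (inord 2))%N.
Proof.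
rewrite !big_ord_recr big_ord0 /= mul1n.
by congr (F _ * F _ * F _)%N; apply/val_inj; rewrite /= inordK.
Qed.

(** The contribution of one axis to the count. Along a free axis no derivative is allowed and there
    are k - 3 test monomials; at an end both derivative orders occur, each with only the constant
    test. *)
Let weight (o : option bool) (c : bool) : nat :=
  if o is None then (if c then 0 else k - 3) else 1.

Lemma card_normal (s : {ffun 'I_3 -> option bool}) (alpha : order01) :
  (if normal_to (sub_box T s) alpha then \dim {: moment_space k (sub_box T s)}
   else 0)%N = (\prod_i weight (s i) (alpha i))%N.
Proof.
case: ifPn => [/forallP nor|/forallPn[i]]; last first.
  rewrite negb_imply negbK parallel_sub_box// => /andP[/eqP si ai].
  by rewrite (bigD1 i)//= si ai mul0n.
rewrite dim_Qpoly !parallel_sub_box// -(prod_ord3 (fun i => if s i == None then _ else _)).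
apply: eq_bigr => i _; move: (nor i); rewrite parallel_sub_box//.
by case: (s i) => //=; case: (alpha i).
Qed.

Lemma big_entities (F : box R -> nat) :
  \sum_(G <- entities T) F G =
  \sum_(s : {ffun 'I_3 -> option bool}) F (sub_box T s).
Proof. by rewrite /entities big_map big_enum. Qed.

Lemma size_vertex_dofs : size (vertex_dofs k T) =
  \sum_(s : {ffun 'I_3 -> option bool}) \sum_(alpha : order01)
    (if box_dim (sub_box T s) == 0 then \prod_i weight (s i) (alpha i) else 0)%N.
Proof.
rewrite /vertex_dofs size_allpairs size_filter -sum1_count big_distrl /=.
rewrite big_mkcond big_entities; apply: eq_bigr => s _.
case: ifPn => [dim0|_]; last by rewrite big1.
rewrite mul1n -sum1_size big_enum; apply: eq_bigr => alpha _.
(* No axis of a vertex is free, so every weight is 1. *)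
rewrite big1// => i _.
have: parallel (sub_box T s) i = false.
  move: dim0; rewrite /box_dim cards_eq0 => /eqP/setP/(_ i).
  by rewrite !inE.
by rewrite parallel_sub_box//; case: (s i).
Qed.

Variable b : forall G : box R, order01 -> seq (moment_space k G).
Hypothesis hb : forall G alpha, basis_of {: moment_space k G} (b G alpha).

Lemma size_moment_dofs d : size (moment_dofs T b d) =
  \sum_(s : {ffun 'I_3 -> option bool}) \sum_(alpha : order01)
    (if box_dim (sub_box T s) == d then \prod_i weight (s i) (alpha i) else 0)%N.
Proof.
rewrite /moment_dofs size_flatten /shape -map_comp sumnE big_map big_filter.
rewrite big_mkcond big_allpairs big_entities; apply: eq_bigr => s _.
rewrite big_enum; apply: eq_bigr => alpha _ /=.
case: (box_dim _ == d) => //=; rewrite -card_normal; case: ifP => // _.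
by rewrite size_map; have /andP[/eqP <- /eqP] := hb (sub_box T s) alpha.
Qed.

Lemma size_dofs : (3 <= k)%N -> size (dofs T b) = (k.+1 ^ 3)%N.
Proof.
move=> k3.
rewrite /dofs !size_cat !size_moment_dofs size_vertex_dofs -!big_split /=.
transitivity (\sum_(s : {ffun 'I_3 -> option bool}) \sum_(alpha : order01)
   \prod_i weight (s i) (alpha i))%N.
  apply: eq_bigr => s _; rewrite -!big_split; apply: eq_bigr => alpha _ /=.
  (* Exactly one of the dimensions 0 to 3 matches, so the four lists together count each pair
     once. *)
  have : (box_dim (sub_box T s) <= #|'I_3|)%N by exact: max_card.
  rewrite card_ord.
  by case: (box_dim _) => [|[|[|[|//]]]] _ /=; rewrite ?(addn0, add0n).
transitivity (\sum_(s : {ffun 'I_3 -> option bool}) \prod_i \sum_c weight (s i) c)%N.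
  by apply: eq_bigr => s _; rewrite bigA_distr_bigA.
(* The sum of products becomes the cube of the count (k - 3) + 2 + 2 for one axis. *)
rewrite -(bigA_distr_bigA (fun _ o => \sum_c weight o c))/= prod_nat_const card_ord.
by rewrite sum_option_bool !big_bool /weight; congr (_ ^ 3) => /=; lia.
Qed.

End Counting.

(** * Linearity of the degrees of freedom and the proof of unisolvence *)

Section Unisolvence.
Context {R : realType}.

Lemma big_monoms_of (a b c : nat) (F : monomial -> R) (q : Qpoly a b c) :
  \sum_(m <- monoms_of q) F m = \sum_(e : 'I_a * 'I_b * 'I_c)
    F ((q : {ffun 'I_a * 'I_b * 'I_c -> R^o}) e,
     (nat_of_ord e.1.1, nat_of_ord e.1.2, nat_of_ord e.2)).
Proof. by rewrite /monoms_of big_map big_enum. Qed.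

Lemma monoms_of_linear (a b c : nat) (F : nat * nat * nat -> R) (t : R)
    (q q' : Qpoly a b c) :
  \sum_(m <- monoms_of (t *: q + q')) m.1 * F m.2 =
  t * (\sum_(m <- monoms_of q) m.1 * F m.2) + \sum_(m <- monoms_of q') m.1 * F m.2.
Proof.
rewrite !big_monoms_of mulr_sumr -big_split/=.
by apply: eq_bigr => e _; rewrite !ffunE mulrDl -mulrA.
Qed.

Lemma tens_linear (a b c : nat) (l0 l1 l2 : nat -> R) (t : R) (u v : Qpoly a b c) :
  tens l0 l1 l2 (monoms_of (t *: u + v)) =
  t * tens l0 l1 l2 (monoms_of u) + tens l0 l1 l2 (monoms_of v).
Proof.
exact: (monoms_of_linear _ _ _ (fun e => l0 e.1.1 * l1 e.1.2 * l2 e.2)).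
Qed.

Lemma vertex_dof_linear (k : nat) (x : space3 R) (alpha : order01) :
  linear (vertex_dof (k := k) x alpha : _ -> R^o).
Proof.
by move=> t u v; rewrite /vertex_dof !Qeval_monoms !multi_partial_monoms tens_linear.
Qed.

Lemma moment_linear (k : nat) (G : box R) (alpha : order01)
    (q : moment_space k G) : linear (moment alpha q : _ -> R^o).
Proof.
move=> t u v; rewrite !moment_tens scaler_sumr -big_split /=.
by apply: eq_bigr => m _; rewrite tens_linear /GRing.scale /=; ring.
Qed.

Lemma moment_linear_test (k : nat) (G : box R) (alpha : order01)
    (u : shape_space k) :
  linear ((fun q : moment_space k G => moment alpha q u) : _ -> R^o).
Proof.
move=> t q q'; rewrite !moment_tens.
exact: (monoms_of_linear _ _ _ (fun e =>
  tens (hermite_functional _ _ _ e.1.1) (hermite_functional _ _ _ e.1.2)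
    (hermite_functional _ _ _ e.2) _)).
Qed.

(** Linearity in the test polynomial carries vanishing from the arbitrary given basis to the
    monomials used in [moment_eq0_tens]. *)
Lemma moment_eq0_basis (k : nat) (G : box R) (alpha : order01)
    (u : shape_space k) (b : seq (moment_space k G)) :
  basis_of {: moment_space k G} b ->
  (forall q : moment_space k G, q \in b -> moment alpha q u = 0) ->
  forall q : moment_space k G, moment alpha q u = 0.
Proof.
move=> hb b0 q.
pose f : {linear moment_space k G -> R^o} := HB.pack
  ((fun q : moment_space k G => moment alpha q u) : _ -> R^o)
  (GRing.isLinear.Build _ _ _ _ _ (moment_linear_test k G alpha u)).
have : q \in <<in_tuple b>>%VS by rewrite (span_basis hb) memvf.
rewrite -[LHS]/(f q) => /coord_span ->.
rewrite linear_sum big1// => i _; rewrite linearZ /=.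
by rewrite [X in _ *: X]b0 ?scaler0// mem_nth.
Qed.

Lemma mem_entities (T : box R) (s : 'I_3 -> option bool) :
  sub_box T s \in entities T.
Proof.
rewrite (_ : sub_box T s = sub_box T [ffun i => s i]).
  by apply/mapP; exists [ffun i => s i]; rewrite ?mem_enum.
by congr sub_box; apply/funext => i; rewrite ffunE.
Qed.

Lemma box_dim_sub_box (T : box R) (s : 'I_3 -> option bool) : cuboid T ->
  box_dim (sub_box T s) = #|[set i | s i == None]%SET|.
Proof.
by move=> cT; apply: eq_card => i; rewrite !inE parallel_sub_box.
Qed.

Lemma dofs_unisolvent (k : nat) (T : box R)
    (b : forall G : box R, order01 -> seq (moment_space k G)) :
  (3 <= k)%N -> cuboid T ->
  (forall G alpha, basis_of {: moment_space k G} (b G alpha)) ->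
  unisolvent (dofs T b).
Proof.
move=> k3 cT hb.
have linL : forall l, l \in dofs T b -> linear (l : _ -> R^o).
  move=> l; rewrite /dofs !mem_cat => /orP[|/or3P H].
    by case/allpairsP => -[G alpha] [_ _ ->]; exact: vertex_dof_linear.
  have [d] : exists d, l \in moment_dofs T b d by case: H; [exists 1%N|exists 2|exists 3].
  case/flatten_mapP => -[G alpha] _ /mapP[q _ ->]; exact: moment_linear.
split=> //; apply: basis_of_dual => //.
  by rewrite size_dofs// dim_Qpoly; rewrite !expnS expn0 muln1 mulnA.
move=> u u0; apply: shape_eq0.
(* With all three axes free, the conclusion covers every tensor product, as [shape_eq0] requires. *)
have H := dofs_eq0_tens k T (fun=> None) u k3 cT.
move=> l0 l1 l2; apply: H => // [s' alpha _ s'N|s' alpha _ [i0 si0] nor q].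
  apply: u0; rewrite /dofs mem_cat; apply/orP; left.
  apply/allpairsP; exists (sub_box T s', alpha); split=> //=; last by rewrite mem_enum.
  rewrite mem_filter mem_entities andbT box_dim_sub_box// cards_eq0.
  by apply/eqP/setP => i; rewrite !inE; apply/eqP.
apply: (moment_eq0_basis _ _ _ _ _ (hb _ alpha)) => {}q qb; apply: u0.
(* A free axis exists, so the dimension is 1, 2 or 3 and the moment lies in one of the three
   lists. *)
suff : moment alpha q \in moment_dofs T b (box_dim (sub_box T s')).
  have : (0 < box_dim (sub_box T s') <= 3)%N.
    rewrite card_gt0; apply/andP; split; last first.
      by have := max_card [set i | parallel (sub_box T s') i]%SET; rewrite card_ord.
    by apply/set0Pn; exists i0; rewrite inE parallel_sub_box// si0.
  rewrite /dofs !mem_cat.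
  by case: (box_dim _) => [|[|[|[|//]]]] //= _ ->; rewrite ?orbT.
apply/flatten_mapP; exists (sub_box T s', alpha); last exact: map_f.
rewrite mem_filter /= eqxx nor /=; apply/allpairsP.
by exists (sub_box T s', alpha); rewrite mem_entities mem_enum.
Qed.

End Unisolvence.

(** * Traces on common entities *)

Section Mesh.
Context {R : realType}.
Implicit Types (T G : box R) (s : 'I_3 -> option bool).

Definition open_box (T : box R) : set (space3 R) :=
  [set x | forall i, lo T i < coord x i < hi T i].

Lemma open_open_box T : open (open_box T).
Proof.
have oc i : open [set x : space3 R | lo T i < coord x i < hi T i].
  rewrite (_ : [set _ | _] = (fun x => coord x i) @^-1` `]lo T i, hi T i[%classic).
    by apply: open_comp => [x _|]; [exact: continuous_coord|exact: interval_open].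
  by apply/seteqP; split=> x /=; rewrite in_itv.
rewrite (_ : open_box T = [set x | lo T (inord 0) < coord x (inord 0) < hi T (inord 0)] `&`
  [set x | lo T (inord 1) < coord x (inord 1) < hi T (inord 1)] `&`
  [set x | lo T (inord 2) < coord x (inord 2) < hi T (inord 2)]).
  by apply: openI => //; exact: openI.
apply/seteqP; split=> [x H|x [[h0 h1] h2]]; first by split; [split|]; exact: H.
exact: ord3P.
Qed.

Lemma open_box_interior T : open_box T `<=` (box_set T)°.
Proof.
rewrite -open_subsetE; last exact: open_open_box.
by move=> x xT i; have /andP[/ltW -> /ltW ->] := xT i.
Qed.

Lemma open_box_nonempty T : cuboid T -> open_box T !=set0.
Proof.
move=> cT; exists (mkspace3 (fun i => (lo T i + hi T i) / 2)) => i.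
rewrite coord_mkspace3; have := cT i; rewrite /parallel => ?.
by apply/andP; split; lra.
Qed.

Definition refines (s s' : 'I_3 -> option bool) : Prop :=
  forall i, s i = None \/ s' i = s i.

Lemma sub_box_subset T s s' : cuboid T -> refines s s' ->
  box_set (sub_box T s') `<=` box_set (sub_box T s).
Proof.
move=> cT ss' x xs' i; move: (xs' i); rewrite !lo_sub_box !hi_sub_box.
have := cT i; rewrite /parallel => /ltW lohi.
case: (ss' i) => [->|-> //]; case: (s' i) => [[]|//] /andP[xl xh].
  by rewrite xh (le_trans lohi).
by rewrite xl (le_trans xh).
Qed.

Lemma box_setN T s : (forall i, s i = None) -> box_set (sub_box T s) = box_set T.
Proof.
by move=> sN; apply/seteqP; split=> x xT i; move: (xT i);
  rewrite lo_sub_box hi_sub_box sN.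
Qed.

Lemma multi_partial_linear (k : nat) (alpha : 'I_3 -> bool) (t : R)
    (u v : shape_space k) x :
  multi_partial (fun i => alpha i) (Qeval (t *: u + v)) x =
  t * multi_partial (fun i => alpha i) (Qeval u) x +
  multi_partial (fun i => alpha i) (Qeval v) x.
Proof. by rewrite !Qeval_monoms !multi_partial_monoms tens_linear. Qed.

(** The difference [d] of two pieces is again a shape function, and its degrees of freedom on the
    common entity and its sub-entities vanish, so [dofs_eq0_tens] applies to [d]. *)
Lemma pieces_agree (k : nat) (Omega : set (space3 R)) (Th : seq (box R))
    (p : box R -> shape_space k) : (3 <= k)%N -> is_mesh Omega Th ->
  (forall (T T' G : box R) alpha, T \in Th -> T' \in Th ->
    G \in entities T -> box_dim G = 0%N -> box_set G `<=` box_set T' ->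
    vertex_dof G.1 alpha (p T) = vertex_dof G.1 alpha (p T')) ->
  (forall (T T' G : box R) alpha (q : moment_space k G),
    T \in Th -> T' \in Th -> G \in entities T -> (1 <= box_dim G <= 2)%N ->
    box_set G `<=` box_set T' -> normal_to G alpha ->
    moment alpha q (p T) = moment alpha q (p T')) ->
  forall T T' x (alpha : 'I_3 -> bool), T \in Th -> T' \in Th ->
    box_set T x -> box_set T' x ->
    multi_partial (fun i => alpha i) (Qeval (p T)) x =
    multi_partial (fun i => alpha i) (Qeval (p T')) x.
Proof.
move=> k3 [cub _ disj conf] vdof mdof T T' x alpha TTh T'Th xT xT'.
have [->//|TT'] := eqVneq T T'; have cT := cub _ TTh.
have [I0|[G [GT _ TIT']]] := conf _ _ TTh T'Th TT'.
  by have : (box_set T `&` box_set T') x by []; rewrite I0.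
have [s GE] : exists s, G = sub_box T s by case/mapP: GT => s _ ->; exists s.
rewrite GE in TIT'.
have GT' : box_set (sub_box T s) `<=` box_set T' by rewrite -TIT'; exact: subIsetr.
(* The common entity is not all of [T]: otherwise the interior of [T] would lie in that of [T'].
   Hence its dimension is at most 2, the range in which the degrees of freedom are shared. *)
have [i0 si0] : exists i, s i <> None.
  apply: contrapT => /forallNP sN; have [y yT] := open_box_nonempty T cT.
  have : ((box_set T)° `&` (box_set T')°) y.
    split; first exact: open_box_interior.
    move/open_box_interior: yT; apply: interiorS.
    by rewrite -(box_setN T s)// => i; apply: contrapT; exact: sN.
  by rewrite disj.
have sub s' : refines s s' -> box_set (sub_box T s') `<=` box_set T'.
  by move=> ss'; apply: subset_trans GT'; exact: sub_box_subset.
have dim2 s' : refines s s' -> (box_dim (sub_box T s') <= 2)%N.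
  move=> ss'; rewrite box_dim_sub_box//.
  rewrite (leq_trans (n := #|[set~ i0]%SET|))//; last by rewrite cardsC1 card_ord.
  apply/subset_leq_card/fintype.subsetP => i; rewrite !inE => /eqP si.
  by apply/eqP => ii0; case: (ss' i0) => // si0'; apply: si0; rewrite -si0' -ii0.
pose d := (-1) *: p T' + p T.
suff : multi_partial (fun i => alpha i) (Qeval d) x = 0.
  by rewrite /d multi_partial_linear mulN1r addrC => /eqP; rewrite subr_eq0 => /eqP.
apply: (multi_partial_eq0 k T s d cT); last by rewrite -TIT'.
apply: dofs_eq0_tens => // [s' beta ss' s'N|s' beta ss' [i si] nor q].
  rewrite /d vertex_dof_linear scaleN1r addrC; apply/eqP; rewrite subr_eq0.
  apply/eqP/vdof => //; [exact: mem_entities| |exact: sub].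
  rewrite box_dim_sub_box//; apply/eqP; rewrite cards_eq0.
  by apply/eqP/setP => i; rewrite !inE; apply/eqP.
rewrite /d moment_linear scaleN1r addrC; apply/eqP; rewrite subr_eq0.
apply/eqP/mdof => //; [exact: mem_entities| |exact: sub].
rewrite dim2// andbT card_gt0; apply/set0Pn; exists i.
by rewrite inE parallel_sub_box// si.
Qed.

End Mesh.

(** * Measurability and integration *)

Section Measurability.
Context {R : realType}.
Local Notation mspace3 :=
  (measurableTypeR R * measurableTypeR R * measurableTypeR R)%type.

(** An open set is the countable union of the products of three intervals, with rational centres and
    radii, that it contains; such products are measurable for the product sigma-algebra. *)
Lemma open_measurable_space3 (O : set (space3 R)) : open O ->
  measurable (O : set mspace3).
Proof.
move=> oO.
pose B (q : rat * rat * rat * rat) : set mspace3 :=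
  (ball (ratr q.1.1.1 : R) (ratr q.2) `*` ball (ratr q.1.1.2 : R) (ratr q.2))
  `*` ball (ratr q.1.2 : R) (ratr q.2).
pose F q := if `[< B q `<=` (O : set mspace3) >] then B q else set0.
have -> : (O : set mspace3) = \bigcup_q F q.
  apply/seteqP; split=> [x Ox|x [q _]]; last first.
    by rewrite /F; case: ifP => // /asboolP qO /qO.
  have : nbhs (x : space3 R) O by exact: open_nbhs_nbhs.
  move=> /nbhs_ballP[e /= e0 eO].
  (* With r < e / 2, two points within r of the same rational centre are within e of each other. *)
  have [r] := rat_in_itvoo (divr_gt0 e0 (ltr0n R 2)).
  rewrite in_itv /= => /andP[r0 re].
  have near y : exists c : rat, ball (ratr c : R) (ratr r) y.
    have [|c] := @rat_in_itvoo R (y - ratr r) (y + ratr r); first by lra.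
    rewrite in_itv /= => /andP[cl cr]; exists c.
    by rewrite /ball /= ltr_norml; apply/andP; split; lra.
  have [c0 xc0] := near x.1.1.
  have [c1 xc1] := near x.1.2.
  have [c2 xc2] := near x.2.
  exists (c0, c1, c2, r) => //; rewrite /F ifT//; apply/asboolP => y [[y0 y1] y2].
  have cl (a b c : R) : ball c (ratr r) a -> ball c (ratr r) b -> ball a e b.
    move=> ca cb; apply: (@le_ball _ _ a (ratr r + ratr r)); first by lra.
    exact: ball_triangle (ball_sym ca) cb.
  by apply: eO; split; [split|] => /=; [exact: cl xc0 y0|exact: cl xc1 y1|exact: cl xc2 y2].
apply: countable_bigcupT_measurable => [|q]; first exact: countableP.
rewrite /F; case: ifP => // _.
apply: measurableX; [apply: measurableX|]; exact: measurable_ball.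
Qed.

Lemma continuous_measurable_space3 (f : space3 R -> R) : continuous f ->
  measurable_fun setT (f : mspace3 -> measurableTypeR R).
Proof.
move=> /continuousP cf; apply: (measurability _ (RGenOpens.measurableE R)).
move=> _ [_ [a [b ->] <-]]; rewrite setTI; apply: open_measurable_space3.
exact/cf/interval_open.
Qed.

Lemma box_setE (T : box R) : box_set T =
  (`[lo T (inord 0), hi T (inord 0)] `*` `[lo T (inord 1), hi T (inord 1)])
  `*` `[lo T (inord 2), hi T (inord 2)].
Proof.
apply/seteqP; split=> [x xT|x [[x0 x1] x2]].
  have := xT (inord 0); have := xT (inord 1); have := xT (inord 2).
  by rewrite coord0 coord1 coord2 => ? ? ?; split; [split|] => /=; rewrite in_itv.
by apply: ord3P; rewrite ?coord0 ?coord1 ?coord2; move: x0 x1 x2; rewrite /= !in_itv.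
Qed.

Lemma measurable_box_set (T : box R) : measurable (box_set T : set mspace3).
Proof.
rewrite box_setE; apply: measurableX; first apply: measurableX;
exact: measurable_itv.
Qed.

Lemma compact_box_set (T : box R) : compact (box_set T : set (space3 R)).
Proof.
rewrite box_setE; apply: compact_setX; last exact: segment_compact.
by apply: compact_setX; exact: segment_compact.
Qed.

Lemma bounded_on_box (f : space3 R -> R) (T : box R) : continuous f ->
  exists M : R, forall x, box_set T x -> `|f x| <= M.
Proof.
move=> cf; have /compact_bounded [M [_ HM]] : compact (f @` box_set T).
  apply: continuous_compact (compact_box_set T).
  exact: continuous_subspaceT.
by exists (M + 1) => x xT; apply: (HM (M + 1)); [lra|exists x].
Qed.

(* On a common face of several boxes, the first box of the list decides. *)
Definition piecewise (Th : seq (box R)) (f : box R -> space3 R -> R)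
    (x : space3 R) : R :=
  if ohead [seq T <- Th | `[< box_set T x >]] is Some T then f T x else 0.

Lemma piecewise_cons (T : box R) Th f x : piecewise (T :: Th) f x =
  if `[< box_set T x >] then f T x else piecewise Th f x.
Proof. by rewrite /piecewise /=; case: ifP. Qed.

Lemma measurable_piecewise Th f : (forall T, continuous (f T)) ->
  measurable_fun setT (piecewise Th f : mspace3 -> measurableTypeR R).
Proof.
move=> cf; elim: Th => [|T Th IH]; first exact: measurable_cst.
rewrite (_ : piecewise _ _ = fun x => if `[< box_set T x >] then f T x
    else piecewise Th f x); last by apply/funext => x; rewrite piecewise_cons.
apply: measurable_fun_ifT => //; last exact: continuous_measurable_space3.
apply: (measurable_fun_bool true); rewrite setTI.
rewrite (_ : _ @^-1` _ = (box_set T : set mspace3)); first exact: measurable_box_set.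
by apply/seteqP; split=> x /= /asboolP.
Qed.

Lemma bounded_piecewise Th f : (forall T, continuous (f T)) ->
  exists M, forall x, `|piecewise Th f x| <= M.
Proof.
move=> cf; elim: Th => [|T Th [M HM]]; first by exists 0 => x; rewrite normr0.
have [N HN] := bounded_on_box (f T) T (cf T).
exists (Num.max M N) => x; rewrite piecewise_cons le_max.
by case: asboolP => [/HN ->|_]; rewrite ?orbT// HM.
Qed.

Lemma piecewise_out Th f x :
  (forall T, T \in Th -> ~ box_set T x) -> piecewise Th f x = 0.
Proof.
elim: Th => [//|T Th IH] H; rewrite piecewise_cons.
rewrite asboolF; last by apply: H; rewrite inE eqxx.
by apply: IH => T' T'Th; apply: H; rewrite inE T'Th orbT.
Qed.

Definition cube (r : R) : box R :=
  (mkspace3 (fun=> - r), mkspace3 (fun=> r)).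

Lemma cubeP r x : box_set (cube r) x <-> forall i, `|coord x i| <= r.
Proof.
by split=> H i; move: (H i); rewrite /lo /hi !coord_mkspace3 ler_norml.
Qed.

Lemma boxes_in_cube (Th : seq (box R)) :
  exists r, forall T x, T \in Th -> box_set T x -> box_set (cube r) x.
Proof.
elim: Th => [|T Th [r Hr]]; first by exists 0.
have [M0 HM0] := bounded_on_box _ T (continuous_coord (inord 0)).
have [M1 HM1] := bounded_on_box _ T (continuous_coord (inord 1)).
have [M2 HM2] := bounded_on_box _ T (continuous_coord (inord 2)).
exists (Num.max r (Num.max M0 (Num.max M1 M2))) => T' x.
rewrite inE => /orP[/eqP -> xT|T'Th xT'].
  by apply/cubeP; apply: ord3P; rewrite !le_max ?HM0 ?HM1 ?HM2 ?orbT.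
by apply/cubeP => i; rewrite le_max; have /cubeP -> := Hr T' x T'Th xT'.
Qed.

End Measurability.

(** * Integrability, Fubini along lines and square integrability *)

Section Integrability.
Context {R : realType}.
Local Notation mspace2 := (measurableTypeR R * measurableTypeR R)%type.
Local Notation mspace3 := (mspace2 * measurableTypeR R)%type.

Lemma integrable_bounded d (T : measurableType d)
    (mu : {measure set T -> \bar R}) (h : T -> R) (B : set T) (M : R) :
  measurable B -> (mu B < +oo)%E -> measurable_fun setT h ->
  (forall x, `|h x| <= M) -> (forall x, ~ B x -> h x = 0) ->
  mu.-integrable setT (EFin \o h).
Proof.
move=> mB Bfin mh hM h0.
have hB : h = h \_ B.
  apply/funext => x; rewrite patchE; case: ifPn => // /negP xB.
  by apply: h0 => Bx; apply: xB; rewrite inE.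
rewrite hB -restrict_EFin -integrable_mkcond//.
apply: measurable_bounded_integrable => //; first exact: measurable_funS mh.
by exists M; split; [exact: num_real|move=> x Mx y _; exact: le_trans (hM y) (ltW Mx)].
Qed.

Lemma lebesgue_measure_itvcc_fin (a b : R) :
  (lebesgue_measure (`[a, b]%classic : set (measurableTypeR R)) < +oo)%E.
Proof. by rewrite lebesgue_measure_itv/=; case: ifP => //; rewrite -EFinB ltry. Qed.

Lemma lebesgue2_itv_fin (a b c d : R) :
  ((lebesgue_measure \x lebesgue_measure)%E
     (`[a, b]%classic `*` `[c, d]%classic : set mspace2) < +oo)%E.
Proof.
rewrite product_measure1E; [|exact: measurable_itv..].
by apply: lte_mul_pinfty => //; rewrite ?ge0_fin_numE//; exact: lebesgue_measure_itvcc_fin.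
Qed.

Lemma lebesgue3_setX (A B C : set (measurableTypeR R)) :
  measurable A -> measurable B -> measurable C ->
  lebesgue3 ((A `*` B) `*` C : set mspace3) =
  (lebesgue_measure A * lebesgue_measure B * lebesgue_measure C)%E.
Proof.
move=> mA mB mC; apply: etrans (product_measure1E _ _ _ _) _ => //.
  exact: measurableX.
by congr (_ * _)%E; exact: product_measure1E.
Qed.

Lemma lebesgue3_box_fin (T : box R) : (lebesgue3 (box_set T) < +oo)%E.
Proof.
rewrite box_setE lebesgue3_setX; try exact: measurable_itv.
have fin (a b : R) : (lebesgue_measure (`[a, b]%classic : set (measurableTypeR R))
    \is a fin_num)%E.
  by rewrite ge0_fin_numE//; exact: lebesgue_measure_itvcc_fin.
by rewrite lte_mul_pinfty ?mule_ge0 ?fin_numM//; exact: lebesgue_measure_itvcc_fin.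
Qed.

Lemma space3E (x1 x2 x3 t : R) (i : 'I_3) :
  ((x1, x2, x3) : space3 R) + t *: basis_vector i =
  (x1 + t * (inord 0 == i)%:R, x2 + t * (inord 1 == i)%:R, x3 + t * (inord 2 == i)%:R).
Proof.
apply: coord_inj => j; rewrite coordD coordZ coord_basis.
by move: j; apply: ord3P; rewrite !(coord0, coord1, coord2).
Qed.

Lemma integral_prod_eq0l d1 d2 (T1 : measurableType d1) (T2 : measurableType d2)
    (m1 : {sigma_finite_measure set T1 -> \bar R})
    (m2 : {sigma_finite_measure set T2 -> \bar R}) (f : T1 * T2 -> \bar R) :
  (m1 \x m2)%E.-integrable setT f ->
  (forall y, (\int[m1]_x f (x, y) = 0)%E) -> (\int[m1 \x m2]_z f z = 0)%E.
Proof.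
by move=> fi f0; rewrite -integral21_prod_meas1//; apply: integral0_eq => y _; exact: f0.
Qed.

Lemma integral_prod_eq0r d1 d2 (T1 : measurableType d1) (T2 : measurableType d2)
    (m1 : {sigma_finite_measure set T1 -> \bar R})
    (m2 : {sigma_finite_measure set T2 -> \bar R}) (f : T1 * T2 -> \bar R) :
  (m1 \x m2)%E.-integrable setT f ->
  (forall x, (\int[m2]_y f (x, y) = 0)%E) -> (\int[m1 \x m2]_z f z = 0)%E.
Proof.
by move=> fi f0; rewrite -integral12_prod_meas1//; apply: integral0_eq => x _; exact: f0.
Qed.

(* The library's canonical sigma-finite structure on a product measure applies to
   subprobabilities only. *)
Lemma lebesgue2_sigma_finite :
  sigma_finite setT ((lebesgue_measure \x lebesgue_measure)%E : set mspace2 -> \bar R).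
Proof.
exists (fun n : nat => `[- n%:R, n%:R]%classic `*` `[- n%:R, n%:R]%classic).
  apply/esym/seteqP; split=> // -[x y] _.
  have := archi_boundP (addr_ge0 (normr_ge0 x) (normr_ge0 y)).
  set n := Num.bound _ => xyn; exists n => //.
  by split; rewrite /= in_itv /= -ler_norml; apply: le_trans (ltW xyn);
    rewrite ?lerDl ?lerDr.
move=> n; split; first by apply: measurableX; exact: measurable_itv.
exact: lebesgue2_itv_fin.
Qed.

(** Fubini with axis [i] innermost. Boundedness and support in a cube make [h] integrable on the
    space and on each section by a plane of constant third coordinate. *)
Lemma integral_lines_eq0 (h : space3 R -> R) (r M : R) (i : 'I_3) :
  measurable_fun setT (h : mspace3 -> measurableTypeR R) ->
  (forall x, `|h x| <= M) -> (forall x, ~ box_set (cube r) x -> h x = 0) ->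
  (forall x, (\int[lebesgue_measure]_t (h (x + t *: basis_vector i))%:E = 0)%E) ->
  (\int[lebesgue3]_x (h x)%:E = 0)%E.
Proof.
move=> mh hM h0 hl.
have mcube := measurable_box_set (cube r).
have ih : lebesgue3.-integrable setT (EFin \o (h : mspace3 -> R)).
  exact: integrable_bounded mcube (lebesgue3_box_fin _) mh hM h0.
have msec (y : R) : measurable_fun setT ((fun z => h (z, y)) : mspace2 -> measurableTypeR R).
  by apply: (measurableT_comp mh); exact: measurable_pair2.
pose c2 : set mspace2 := `[- r, r]%classic `*` `[- r, r]%classic.
have mc2 : measurable c2 by apply: measurableX; exact: measurable_itv.
have c2fin : ((lebesgue_measure \x lebesgue_measure)%E c2 < +oo)%E.
  exact: lebesgue2_itv_fin.
have isec (y : R) : (lebesgue_measure \x lebesgue_measure)%E.-integrable setT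
    (EFin \o (fun z : mspace2 => h (z, y))).
  apply: (integrable_bounded _ _ _ _ _ M mc2 c2fin (msec y)) => [x|[x1 x2] x12].
    exact: hM.
  apply: h0 => /cubeP H; apply: x12; have := H (inord 0); have := H (inord 1).
  by rewrite coord0 coord1 /= !ler_norml => ? ?; split; rewrite /= in_itv.
pose m2 : {sigma_finite_measure set mspace2 -> \bar R} :=
  HB.pack (lebesgue_measure \x lebesgue_measure)%E
    (Measure_isSigmaFinite.Build _ _ _ (lebesgue_measure \x lebesgue_measure)%E
      lebesgue2_sigma_finite).
have ih' : (m2 \x lebesgue_measure)%E.-integrable setT (EFin \o (h : mspace3 -> R)).
  exact: ih.
suff : (\int[m2 \x lebesgue_measure]_z (EFin \o (h : mspace3 -> R)) z = 0)%E by [].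
move: i hl; apply: ord3P => hl.
- apply: (@integral_prod_eq0l _ _ _ _ m2 lebesgue_measure _ ih') => x3.
  apply: (@integral_prod_eq0l _ _ _ _ lebesgue_measure lebesgue_measure _ (isec x3)) => x2.
  (* Basing the line at coordinate 0 makes its parameter the integration variable. *)
  rewrite -[RHS](hl (0, x2, x3)); apply: eq_integral => x1 _.
  by rewrite space3E !inord3_eq//= add0r !mulr0 mulr1 !addr0.
- apply: (@integral_prod_eq0l _ _ _ _ m2 lebesgue_measure _ ih') => x3.
  apply: (@integral_prod_eq0r _ _ _ _ lebesgue_measure lebesgue_measure _ (isec x3)) => x1.
  rewrite -[RHS](hl (x1, 0, x3)); apply: eq_integral => x2 _.
  by rewrite space3E !inord3_eq//= add0r !mulr0 mulr1 !addr0.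
- apply: (@integral_prod_eq0r _ _ _ _ m2 lebesgue_measure _ ih') => -[x1 x2].
  rewrite -[RHS](hl (x1, x2, 0)); apply: eq_integral => x3 _.
  by rewrite space3E !inord3_eq//= add0r !mulr0 mulr1 !addr0.
Qed.

Lemma L2_bounded (h : space3 R -> R) (Omega : set (space3 R)) (r M : R) :
  open Omega -> measurable_fun setT (h : mspace3 -> measurableTypeR R) ->
  (forall x, `|h x| <= M) -> (forall x, ~ box_set (cube r) x -> h x = 0) ->
  L2 Omega h.
Proof.
move=> oO mh hM h0; have mO := open_measurable_space3 _ oO.
pose g := h \_ Omega.
have mg : measurable_fun setT (g : mspace3 -> measurableTypeR R).
  by apply/(measurable_restrictT _ mO); exact: measurable_funTS mh.
have gM x : `|g x| <= M.
  by rewrite /g patchE; case: ifP => // _; rewrite normr0 (le_trans _ (hM x)).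
have g0 x : ~ box_set (cube r) x -> g x = 0.
  by rewrite /g patchE; case: ifP => // _ /h0.
rewrite /L2 /=; apply/andP; split; first by rewrite inE.
rewrite inE /= /finite_norm unlock /=; apply: poweR_lty.
have ig2 : lebesgue3.-integrable setT (EFin \o (fun x : mspace3 => g x ^+ 2)).
  apply: (integrable_bounded _ _ _ _ _ (M ^+ 2) (measurable_box_set (cube r))
    (lebesgue3_box_fin _)); first exact: measurable_funX.
    by move=> x; rewrite normrX lerXn2r// nnegrE (le_trans _ (gM x)).
  by move=> x /g0 ->; rewrite expr0n.
have /integrableP[_] := ig2; apply: le_lt_trans.
rewrite le_eqVlt; apply/orP; left; apply/eqP; apply: eq_integral => x _ /=.
by rewrite powR_mulrn// normrX.
Qed.

End Integrability.

(** * Integration by parts for piecewise smooth functions *)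

Section Lines.
Context {R : realType}.
Implicit Types (x : space3 R) (i : 'I_3).

Lemma is_derive_line (f : space3 R -> R) x i (t : R) :
  derivable f (x + t *: basis_vector i) (basis_vector i) ->
  is_derive t 1 (fun s : R => f (x + s *: basis_vector i) : R^o)
    (partial i f (x + t *: basis_vector i)).
Proof.
move=> df.
have E : (fun h : R => h^-1 *: (((fun s : R => f (x + s *: basis_vector i) : R^o)
      \o shift t) (h *: 1) - f (x + t *: basis_vector i))) =
   (fun h : R => h^-1 *: ((f \o shift (x + t *: basis_vector i))
      (h *: basis_vector i) - f (x + t *: basis_vector i))).
  apply/funext => h /=; congr (_ *: (f _ - _)).
  by apply: coord_inj => j; rewrite !(coordD, coordZ) /GRing.scale /=; ring.
split; first by rewrite /derivable E; exact: df.
by rewrite /partial /derive E.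
Qed.

Lemma continuous_line x i : continuous (fun t : R => x + t *: basis_vector i).
Proof.
move=> t; apply: cvgD; first exact: cvg_cst.
by apply: cvgZr_tmp; exact: cvg_id.
Qed.

Lemma measurable_line x i : measurable_fun setT
  ((fun t => x + t *: basis_vector i) :
   measurableTypeR R -> measurableTypeR R * measurableTypeR R * measurableTypeR R).
Proof.
case: x => [[x1 x2] x3]; rewrite (_ : (fun _ => _) = (fun t : R =>
  (x1 + t * (inord 0 == i)%:R, x2 + t * (inord 1 == i)%:R, x3 + t * (inord 2 == i)%:R))).
  have m (y c : R) : measurable_fun setT
      ((fun t => y + t * c) : measurableTypeR R -> measurableTypeR R).
    apply: continuous_measurable_fun => t; apply: cvgD; first exact: cvg_cst.
    by apply: cvgMl; exact: cvg_id.
  by apply: measurable_fun_pair; first apply: measurable_fun_pair; exact: m.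
by apply/funext => t; rewrite space3E.
Qed.

(** The point [c] is moved towards the farther end by a third of [m]; as [m] is at most [e] and b -
    a, this stays in [U] and inside the interval. *)
Lemma open_meets_itv (U : set R) (a b c : R) : open U -> U c -> a < b ->
  a <= c <= b -> exists2 t, a < t < b & U t.
Proof.
move=> oU Uc ab /andP[ac cb].
have /nbhs_ballP[e /= e0 eU] : nbhs c U by exact: open_nbhs_nbhs.
pose m := Num.min e (b - a).
have m0 : 0 < m by rewrite /m lt_min e0 subr_gt0.
have me : m <= e by rewrite /m ge_min lexx.
have mb : m <= b - a by rewrite /m ge_min lexx orbT.
have tU t : `|c - t| < e -> U t by move=> ct; exact: eU.
have [cm|cm] := ltP c ((a + b) / 2).
- exists (c + m / 3); first by apply/andP; split; lra.
  by apply: tU; rewrite ltr_norml; apply/andP; split; lra.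
- exists (c - m / 3); first by apply/andP; split; lra.
  by apply: tU; rewrite ltr_norml; apply/andP; split; lra.
Qed.

(** Induction on the breakpoints: an interval with the head [c] inside is split there, and the two
    terms [f c] cancel. *)
Lemma Rintegral_pieces (H f : R -> R) (bp : seq R) :
  (forall a b, (@lebesgue_measure R).-integrable `[a, b]%classic (EFin \o H)) ->
  (forall a b, a < b -> (forall c, c \in bp -> ~~ (a < c < b)) ->
    \int[lebesgue_measure]_(t in `[a, b]) H t = f b - f a) ->
  forall a b, a < b -> \int[lebesgue_measure]_(t in `[a, b]) H t = f b - f a.
Proof.
move=> iH; elim: bp => [|c bp IH] Hbp; first by move=> a b ab; exact: Hbp.
apply: IH => a b ab abp.
have [/andP[ac cb]|cab] := boolP (a < c < b); last first.
  by apply: Hbp => // c'; rewrite inE => /predU1P[->|/abp].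
have E1 : \int[lebesgue_measure]_(t in `[a, c]) H t = f c - f a.
  apply: Hbp => // c'; rewrite inE => /predU1P[->|/abp]; first by rewrite ltxx andbF.
  by apply: contra => /andP[-> /lt_trans->].
have E2 : \int[lebesgue_measure]_(t in `[c, b]) H t = f b - f c.
  apply: Hbp => // c'; rewrite inE => /predU1P[->|/abp]; first by rewrite ltxx.
  by apply: contra => /andP[/(lt_trans ac) -> ->].
have := @Rintegral_itvB R H (BLeft a) (BRight b) c (iH a b).
rewrite !bnd_simp => /(_ (ltW ac) (ltW cb)).
rewrite Rintegral_itv_obnd_cbnd; last first.
  apply: integrableS (iH c b) => //.
  by move=> t /=; rewrite !in_itv /= => /andP[/ltW -> ->].
by rewrite E1 E2 => /eqP; rewrite subr_eq => /eqP ->; ring.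
Qed.

End Lines.

(** * Test functions, integration along one line, and then over the domain *)

Section IntegrationByParts.
Context {R : realType}.
Implicit Types (x : space3 R) (i : 'I_3).
Local Notation mspace3 :=
  (measurableTypeR R * measurableTypeR R * measurableTypeR R)%type.

Lemma smooth_partial (f : space3 R -> R) i : smooth f -> smooth (partial i f).
Proof. by move=> sf s; have := sf (rcons s i); rewrite foldr_rcons. Qed.

Lemma smooth_continuous (f : space3 R -> R) : smooth f -> continuous f.
Proof. by move=> /(_ [::])[]. Qed.

Lemma smooth_derivable (f : space3 R -> R) i x : smooth f ->
  derivable f x (basis_vector i).
Proof. by move=> /(_ [::])[_]; exact. Qed.

Lemma test_function_out (Omega : set (space3 R)) phi x :
  test_function Omega phi -> ~ Omega x -> phi x = 0.
Proof.
move=> [_ [_ supp]] Ox; apply/eqP/negPn/negP => phix; apply: Ox; apply: supp.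
exact: subset_closure.
Qed.

Lemma partial_test_function (Omega : set (space3 R)) phi i :
  test_function Omega phi -> test_function Omega (partial i phi).
Proof.
move=> [sphi [cphi supp]]; split; first exact: smooth_partial.
have sub : closure [set x | partial i phi x != 0] `<=` closure [set x | phi x != 0].
  rewrite [X in _ `<=` X](closure_id (closure _)).1; last exact: closed_closure.
  apply: closureS => x /= dphix; apply: contrapT => phix.
  case/negP: dphix; apply/eqP.
  (* Off its closed support [phi] vanishes in a whole neighbourhood, so its derivative vanishes
     too. *)
  have nx : \forall y \near x, phi y = 0.
    have : nbhs x (~` closure [set x | phi x != 0]).
      by apply: open_nbhs_nbhs; split=> //; apply: closed_openC; exact: closed_closure.
    apply: filterS => y yc; apply/eqP/negPn/negP => phiy; apply: yc.
    exact: subset_closure.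
  by rewrite /partial (near_eq_derive (g := cst 0))// derive_cst.
split; last exact: subset_trans supp.
by apply: (subclosed_compact _ cphi sub); exact: closed_closure.
Qed.

(** The cells cover [Omega] and lie in one cube, on which [phi] is bounded by compactness; outside
    [Omega] it is zero. *)
Lemma test_function_bounded (Omega : set (space3 R)) (Th : seq (box R)) phi :
  (forall x, Omega x -> exists2 T, T \in Th & box_set T x) ->
  test_function Omega phi -> exists M, forall x, `|phi x| <= M.
Proof.
move=> cover tphi; have [r Hr] := boxes_in_cube Th.
have [M HM] := bounded_on_box phi (cube r) (smooth_continuous _ tphi.1).
exists (Num.max M 0) => x; rewrite le_max.
have [/cover[T TTh xT]|Ox] := pselect (Omega x); first by rewrite HM//; exact: Hr xT.
by rewrite (test_function_out _ _ _ tphi Ox) normr0 lexx orbT.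
Qed.

Definition agree (Th : seq (box R)) (F : box R -> space3 R -> R) : Prop :=
  forall T T' x, T \in Th -> T' \in Th -> box_set T x -> box_set T' x ->
  F T x = F T' x.

Lemma piecewise_agree Th F T x : agree Th F -> T \in Th -> box_set T x ->
  piecewise Th F x = F T x.
Proof.
move=> aF TTh xT; rewrite /piecewise.
have : all [pred T' | (T' \in Th) && `[< box_set T' x >]]
    [seq T <- Th | `[< box_set T x >]].
  by apply/allP => T'; rewrite mem_filter /= => /andP[-> ->].
have : T \in [seq T <- Th | `[< box_set T x >]].
  by rewrite mem_filter TTh andbT; apply/asboolP.
case: [seq _ <- _ | _] => [//|T' s] _ /= /andP[/andP[T'Th /asboolP xT'] _].
exact: aF.
Qed.

Variables (Omega : set (space3 R)) (Th : seq (box R)).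
Hypothesis oOmega : open Omega.
Hypothesis cover : forall x, Omega x -> exists2 T, T \in Th & box_set T x.
Variable F : box R -> space3 R -> R.
Hypothesis sF : forall T, smooth (F T).
Hypothesis aF : agree Th F.
Variables (phi : space3 R -> R) (i : 'I_3).
Hypothesis tphi : test_function Omega phi.

Let dF T := partial i (F T).
Let dphi := partial i phi.
(** The product rule expression for the derivative along axis [i] of [piecewise Th F] times [phi].
    Integration by parts amounts to its integral being zero. *)
Let h (x : space3 R) : R := piecewise Th F x * dphi x + piecewise Th dF x * phi x.

Let tdphi : test_function Omega dphi.
Proof. exact: partial_test_function. Qed.

Let cF T : continuous (F T).
Proof. exact: smooth_continuous. Qed.

Let cdF T : continuous (dF T).
Proof. by apply: smooth_continuous; exact: smooth_partial. Qed.

Let h_out x : ~ Omega x -> h x = 0.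
Proof.
move=> Ox; rewrite /h (test_function_out _ _ _ tphi Ox).
by rewrite (test_function_out _ _ _ tdphi Ox) !mulr0 addr0.
Qed.

Let mpiece G psi : (forall T, continuous (G T)) -> continuous psi ->
  measurable_fun setT ((fun x => piecewise Th G x * psi x) : mspace3 -> measurableTypeR R).
Proof.
move=> cG cpsi; apply: measurable_funM; first exact: measurable_piecewise.
exact: continuous_measurable_space3.
Qed.

Let mh : measurable_fun setT (h : mspace3 -> measurableTypeR R).
Proof.
by apply: measurable_funD; apply: mpiece => //; apply: smooth_continuous;
  [exact: tdphi.1|exact: tphi.1].
Qed.

Let bpiece G psi : (forall T, continuous (G T)) -> test_function Omega psi ->
  exists M, forall x, `|piecewise Th G x * psi x| <= M.
Proof.
move=> cG tpsi; have [M HM] := bounded_piecewise Th G cG.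
have [N HN] := test_function_bounded _ _ _ cover tpsi.
by exists (M * N) => x; rewrite normrM ler_pM.
Qed.

Let bh : exists M, forall x, `|h x| <= M.
Proof.
have [M HM] := bpiece F dphi cF tdphi; have [N HN] := bpiece dF phi cdF tphi.
by exists (M + N) => x; rewrite (le_trans (ler_normD _ _))// lerD.
Qed.

Let ih x a b : (@lebesgue_measure R).-integrable `[a, b]%classic
  (EFin \o (fun t => h (x + t *: basis_vector i))).
Proof.
apply: measurable_bounded_integrable => //; first exact: lebesgue_measure_itvcc_fin.
  by apply: measurable_funTS; apply: (measurableT_comp mh); exact: measurable_line.
have [M HM] := bh; exists M; split; first exact: num_real.
by move=> y My z _; exact: le_trans (HM _) (ltW My).
Qed.

(** The primitive of [h] along the line through [x]. *)
Let fl x (t : R) : R :=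
  piecewise Th F (x + t *: basis_vector i) * phi (x + t *: basis_vector i).

(* Between two breakpoints the line through x along axis i either stays in a
   cell or avoids all of them. *)
Let breakpoints x : seq R :=
  flatten [seq [:: lo T i - coord x i; hi T i - coord x i] | T <- Th].

(** Along the line only coordinate [i] varies, and neither end of [T] on that axis falls strictly
    between [a] and [b]. *)
Let in_cell x a b T (s t : R) : T \in Th -> a < t < b -> a <= s <= b ->
  (forall c, c \in breakpoints x -> ~~ (a < c < b)) ->
  box_set T (x + t *: basis_vector i) -> box_set T (x + s *: basis_vector i).
Proof.
move=> TTh /andP[at_ tb] /andP[as_ sb] bp xT j; have := xT j.
rewrite !coordD !coordZ coord_basis; case: eqVneq => [->|_]; last by rewrite !mulr0.
have bl : lo T i - coord x i \in breakpoints x.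
  by apply/flatten_mapP; exists T => //; rewrite inE eqxx.
have bh' : hi T i - coord x i \in breakpoints x.
  by apply/flatten_mapP; exists T => //; rewrite !inE eqxx orbT.
move: (bp _ bl) (bp _ bh'); rewrite !negb_and -!leNgt !mulr1.
by move=> /orP[?|?] /orP[?|?] /andP[? ?]; apply/andP; split; lra.
Qed.

Let line_piece x a b : a < b ->
  (forall c, c \in breakpoints x -> ~~ (a < c < b)) ->
  \int[lebesgue_measure]_(t in `[a, b]) h (x + t *: basis_vector i) = fl x b - fl x a.
Proof.
move=> ab bp.
have abm : a < (a + b) / 2 < b by apply/andP; split; lra.
pose cells t := [seq T <- Th | `[< box_set T (x + t *: basis_vector i) >]].
have cellsE t : a < t < b -> cells t = cells ((a + b) / 2).
  move=> abt; apply: eq_in_filter => T TTh; apply: asbool_equiv_eq; split.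
    by apply: (in_cell x a b) => //; case/andP: abm => /ltW -> /ltW ->.
  by apply: (in_cell x a b) => //; case/andP: abt => /ltW -> /ltW ->.
(* At the end points [piecewise] may select another cell, whose derivative can differ, so they are
   dropped from the integral. *)
have ioo : \int[lebesgue_measure]_(t in `[a, b]) h (x + t *: basis_vector i) =
    \int[lebesgue_measure]_(t in `]a, b[) h (x + t *: basis_vector i).
  rewrite -Rintegral_itv_bndo_bndc; last first.
    by apply: integrableS (ih x a b) => //; exact: subset_itv_co_cc.
  rewrite Rintegral_itv_obnd_cbnd//.
  by apply: integrableS (ih x a b) => //; exact: subset_itv_oo_cc.
case cm : (cells ((a + b) / 2)) => [|T s].
  have out t : a < t < b -> ~ Omega (x + t *: basis_vector i).
    move=> abt /cover[T TTh xT]; have : T \in cells t.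
      by rewrite mem_filter TTh andbT; apply/asboolP.
    by rewrite cellsE// cm.
  (* An end point in the open set [Omega] would bring nearby interior points of the interval into
     it. *)
  have out' t : a <= t <= b -> ~ Omega (x + t *: basis_vector i).
    move=> abt Ot; pose U := (fun t => x + t *: basis_vector i) @^-1` Omega.
    have oU : open U by apply: open_comp => // ? _; exact: continuous_line.
    by have [u abu Uu] := open_meets_itv U a b t oU Ot ab abt; exact: out Uu.
  rewrite ioo (@eq_Rintegral _ _ _ _ _ (cst 0)); last first.
    by move=> t; rewrite inE /= in_itv /= => /out /h_out.
  rewrite Rintegral_cst// mul0r /fl.
  by rewrite !(test_function_out _ _ _ tphi) ?mulr0 ?subrr//; apply: out';
    rewrite lexx ltW.
have [TTh mT] : T \in Th /\ box_set T (x + ((a + b) / 2) *: basis_vector i).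
  have : T \in cells ((a + b) / 2) by rewrite cm inE eqxx.
  by rewrite mem_filter => /andP[/asboolP].
have inT t : a <= t <= b -> box_set T (x + t *: basis_vector i).
  by move=> abt; exact: (in_cell x a b _ _ _ TTh abm abt bp mT).
(* The cells met are the same throughout the open interval, so [T] is always the first one, for the
   derivatives as well. *)
have pwE G t : a < t < b -> piecewise Th G (x + t *: basis_vector i) =
    G T (x + t *: basis_vector i).
  by move=> abt; rewrite /piecewise -/(cells t) cellsE// cm.
have dFl t := is_derive_line _ _ _ _ (smooth_derivable _ i (x + t *: basis_vector i) (sF T)).
have dphil t := is_derive_line _ _ _ _ (smooth_derivable _ i (x + t *: basis_vector i) tphi.1).
pose G t := F T (x + t *: basis_vector i) * phi (x + t *: basis_vector i).
pose g t := F T (x + t *: basis_vector i) * dphi (x + t *: basis_vector i) +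
  phi (x + t *: basis_vector i) * dF T (x + t *: basis_vector i).
have dG (t : R) : is_derive t (1 : R) (G : R -> R^o) (g t) by exact: is_deriveM (dFl t) (dphil t).
have cl psi : continuous psi ->
    continuous (fun t : R => psi (x + t *: basis_vector i) : R).
  move=> cpsi t; apply: (@continuous_comp _ _ _ (fun t : R => x + t *: basis_vector i) psi).
    exact: continuous_line.
  exact: cpsi.
have cphi := smooth_continuous _ tphi.1.
have cdphi := smooth_continuous _ tdphi.1.
have cG : continuous G by move=> t; apply: cvgM; exact: cl.
have cg : continuous g.
  by move=> t; apply: cvgD; apply: cvgM; exact: cl.
have -> : \int[lebesgue_measure]_(t in `[a, b]) h (x + t *: basis_vector i) =
    \int[lebesgue_measure]_(t in `]a, b[) g t.
  rewrite ioo; apply: eq_Rintegral => t; rewrite inE /= in_itv /= => abt.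
  by rewrite /h !pwE// /g [X in _ + X]mulrC.
rewrite Rintegral_itv_obnd_cbnd; last first.
  by apply: integrableS (continuous_integrable_itv a b g cg) => //; exact: subset_itv_oo_cc.
rewrite Rintegral_itv_bndo_bndc; last first.
  by apply: integrableS (continuous_integrable_itv a b g cg) => //; exact: subset_itv_co_cc.
(* At the end points this uses the agreement of the pieces; it makes the boundary terms of
   neighbouring intervals match. *)
have flE t : a <= t <= b -> fl x t = G t.
  by move=> /inT xT; rewrite /fl (piecewise_agree _ _ _ _ aF TTh xT).
rewrite !flE ?lexx ?ltW// /Rintegral (continuous_FTC2 (F := G) ab)//.
- exact: continuous_subspaceT.
- split.
  + by move=> t _; have [] := dG t.
  + exact/cvg_at_right_filter/cG.
  + exact/cvg_at_left_filter/cG.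
- by move=> t _; rewrite derive1E derive_val.
Qed.

Let line_integral x :
  (\int[lebesgue_measure]_t (h (x + t *: basis_vector i))%:E = 0)%E.
Proof.
have [r Hr] := boxes_in_cube Th.
(* For a parameter of modulus at least [B], coordinate [i] exceeds [r] in modulus and the line is
   outside all cells. *)
pose B := `|r| + `|coord x i| + 1.
have B0 : 0 < B by rewrite /B; have := normr_ge0 r; have := normr_ge0 (coord x i); lra.
have out t : B <= `|t| -> forall T, T \in Th -> ~ box_set T (x + t *: basis_vector i).
  move=> Bt T TTh /(Hr _ _ TTh)/cubeP/(_ i); rewrite coordD coordZ coord_basis eqxx mulr1.
  move=> xt; have : `|t| <= `|coord x i + t| + `|coord x i|.
    by rewrite -{1}[t](addKr (coord x i)) addrC ler_normB.
  by move: Bt; rewrite /B; have := ler_norm r; lra.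
have fl0 t : B <= `|t| -> fl x t = 0.
  by move=> /out tB; rewrite /fl piecewise_out// mul0r.
have hout t : B <= `|t| -> h (x + t *: basis_vector i) = 0.
  by move=> /out tB; rewrite /h !piecewise_out// !mul0r addr0.
have H0 : \int[lebesgue_measure]_(t in `[- B, B]) h (x + t *: basis_vector i) = 0.
  rewrite (Rintegral_pieces _ (fl x) (breakpoints x) (ih x) (line_piece x)); last by lra.
  by rewrite !fl0 ?subrr// ?normrN gtr0_norm.
rewrite -[RHS]/(0%:E) -H0 /Rintegral fineK; last first.
  by apply: integrable_fin_num (ih x (- B) B).
rewrite [RHS]integral_mkcond; apply: eq_integral => t _.
rewrite patchE; case: ifPn => //; rewrite notin_setE /= in_itv /= -ler_norml.
by move=> /negP; rewrite -ltNge => /ltW /hout ->.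
Qed.

Lemma piecewise_by_parts :
  \int[lebesgue3]_(x in Omega) (piecewise Th F x * dphi x) =
  - \int[lebesgue3]_(x in Omega) (piecewise Th dF x * phi x).
Proof.
have restr (psi : space3 R -> R) G : test_function Omega psi ->
    ((fun x => piecewise Th G x * psi x) \_ Omega) = (fun x => piecewise Th G x * psi x).
  move=> tpsi; apply/funext => x; rewrite patchE; case: ifPn => //.
  by rewrite notin_setE => /(test_function_out _ _ _ tpsi) ->; rewrite mulr0.
have [r Hr] := boxes_in_cube Th.
have pout G x : ~ box_set (cube r) x -> piecewise Th G x = 0.
  by move=> xr; apply: piecewise_out => T TTh xT; apply: xr; exact: Hr xT.
have ip G psi : (forall T, continuous (G T)) -> test_function Omega psi ->
    lebesgue3.-integrable setT (EFin \o (fun x => piecewise Th G x * psi x)).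
  move=> cG tpsi; have [M HM] := bpiece G psi cG tpsi.
  apply: (integrable_bounded _ _ _ _ _ M (measurable_box_set (cube r)) (lebesgue3_box_fin _)).
  - by apply: mpiece => //; exact: smooth_continuous tpsi.1.
  - exact: HM.
  - by move=> x /pout ->; rewrite mul0r.
(* Both integrands vanish off [Omega] with the test function, so the integrals extend to the whole
   space. *)
rewrite Rintegral_mkcond restr// [in RHS]Rintegral_mkcond restr//.
apply/eqP; rewrite -addr_eq0; apply/eqP.
rewrite -RintegralD//; [|exact: ip|exact: ip].
have [M HM] := bh.
rewrite /Rintegral (integral_lines_eq0 h r M i mh HM _ line_integral)// => x xr.
by rewrite /h !pout// !mul0r addr0.
Qed.

End IntegrationByParts.

(** * Conformity *)

Section Conformity.
Context {R : realType}.

Lemma plane_negligible (i : 'I_3) (c : R) :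
  (@lebesgue3 R).-negligible [set x | coord x i = c].
Proof.
have mc : measurable ([set c] : set (measurableTypeR R)) by exact: measurable_set1.
move: i; apply: ord3P.
- exists (([set c] `*` setT) `*` setT); split.
  + by apply: measurableX; [exact: measurableX|].
  + by rewrite lebesgue3_setX// lebesgue_measure_set1 !mul0e.
  + by move=> x /=; rewrite coord0 => <-.
- exists ((setT `*` [set c]) `*` setT); split.
  + by apply: measurableX; [exact: measurableX|].
  + by rewrite lebesgue3_setX// lebesgue_measure_set1 mule0 mul0e.
  + by move=> x /=; rewrite coord1 => <-.
- exists ((setT `*` setT) `*` [set c]); split.
  + by apply: measurableX; [exact: measurableX|].
  + by rewrite lebesgue3_setX// lebesgue_measure_set1 mule0.
  + by move=> x /=; rewrite coord2 => <-.
Qed.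

(** The boundaries of the cells lie in finitely many coordinate planes. A finite element function is
    prescribed only off them. *)
Lemma box_boundary_negligible (Th : seq (box R)) : (@lebesgue3 R).-negligible
  [set x | exists2 T, T \in Th & box_set T x /\ ~ open_box T x].
Proof.
elim: Th => [|T Th IH].
  have := @negligible_set0 _ _ _ (@lebesgue3 R).
  by apply: negligibleS => x [T].
have bT : (@lebesgue3 R).-negligible [set x | exists i, coord x i = lo T i \/ coord x i = hi T i].
  pose P i : set (space3 R) := [set x | coord x i = lo T i] `|` [set x | coord x i = hi T i].
  have nP i : (@lebesgue3 R).-negligible (P i).
    by apply: negligibleU; exact: plane_negligible.
  apply: negligibleS (negligibleU (nP (inord 0)) (negligibleU (nP (inord 1)) (nP (inord 2)))).
  by move=> x [i]; move: i; apply: ord3P => H; [left|right; left|right; right].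
apply: negligibleS (negligibleU bT IH) => x [T' ].
rewrite inE => /predU1P[->|T'Th] [xT nxT]; last by right; exists T'.
left; apply: contrapT => /forallNP H; apply: nxT => i; have := xT i.
move: (H i) => /not_orP[/eqP xl /eqP xh].
by rewrite !le_eqVlt eq_sym (negPf xl) (negPf xh).
Qed.

Lemma multi_partialE (alpha : 'I_3 -> nat) (f : space3 R -> R) :
  multi_partial alpha f = foldr partial f (nseq (alpha (inord 0)) (inord 0) ++
    nseq (alpha (inord 1)) (inord 1) ++ nseq (alpha (inord 2)) (inord 2)).
Proof.
have E n (i : 'I_3) (g : space3 R -> R) : iter n (partial i) g = foldr partial g (nseq n i).
  by elim: n => //= n ->.
by rewrite /multi_partial !E !foldr_cat.
Qed.

(** Each integration by parts needs agreement of the pieces being differentiated: [F] for the first,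
    its first derivatives for the second. The resulting second derivatives may jump. *)
Lemma piecewise_weak_partial (Omega : set (space3 R)) (Th : seq (box R))
    (F : box R -> space3 R -> R) (s : seq 'I_3) :
  open Omega -> (forall x, Omega x -> exists2 T, T \in Th & box_set T x) ->
  (forall T, smooth (F T)) -> agree Th F ->
  (forall i, agree Th (fun T => partial i (F T))) -> (size s <= 2)%N ->
  exists2 G, (forall T, smooth (G T)) & forall phi, test_function Omega phi ->
    \int[lebesgue3]_(x in Omega) (piecewise Th F x * foldr partial phi s x) =
    (-1) ^+ size s * \int[lebesgue3]_(x in Omega) (piecewise Th G x * phi x).
Proof.
move=> oO cover sF aF adF; case: s => [|i [|j [|//]]] _.
- by exists F => // phi _; rewrite mul1r.
- exists (fun T => partial i (F T)) => [T|phi tphi]; first exact: smooth_partial.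
  by rewrite mulN1r; exact: piecewise_by_parts.
- exists (fun T => partial j (partial i (F T))) => [T|phi tphi].
    by do 2!apply: smooth_partial.
  (* The outer derivative [i] is moved first, with [partial j phi] as test function, and then [j];
     the two signs cancel. *)
  rewrite /= (piecewise_by_parts _ _ oO cover _ sF aF)//; last exact: partial_test_function.
  rewrite (piecewise_by_parts _ _ oO cover _ _ (adF i))// => [|T]; last exact: smooth_partial.
  by rewrite opprK sqrrN expr1n mul1r.
Qed.

Lemma fe_space_sobolevH2 (k : nat) (Omega : set (space3 R)) (Th : seq (box R)) :
  (3 <= k)%N -> open Omega -> is_mesh Omega Th ->
  fe_space k Omega Th `<=` sobolevH2 Omega.
Proof.
move=> k3 oO mesh u [p [up vdof mdof]].
have ag := pieces_agree k Omega Th p k3 mesh vdof mdof.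
have cover x : Omega x -> exists2 T, T \in Th & box_set T x.
  by move=> /subset_closure; case: mesh => _ -> _ _ [T TTh xT]; exists T.
pose F T := Qeval (p T).
have sF T : smooth (F T) by exact: smooth_Qeval.
have aF : agree Th F.
  by move=> T T' x TTh T'Th xT xT'; exact: (ag T T' x (fun=> false)).
have adF i : agree Th (fun T => partial i (F T)).
  (* The first derivative along [i] is the multi-index with a single 1 at [i]. *)
  move=> T T' x TTh T'Th xT xT'; have := ag T T' x (fun j => j == i) TTh T'Th xT xT'.
  by rewrite /multi_partial; move: i; apply: ord3P; rewrite !inord3_eq.
have L2pw G : (forall T, smooth (G T)) -> L2 Omega (piecewise Th G).
  move=> sG; have cG T : continuous (G T) by exact: smooth_continuous.
  have [r Hr] := boxes_in_cube Th; have [M HM] := bounded_piecewise Th G cG.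
  apply: (L2_bounded _ _ r M oO) => //; first exact: measurable_piecewise.
  by move=> x xr; apply: piecewise_out => T TTh xT; apply: xr; exact: Hr xT.
(* The representative takes the value of a piece on the cell boundaries too, where [u] is
   arbitrary. *)
exists (piecewise Th F); split; [|exact: L2pw|].
- apply: negligibleS (box_boundary_negligible Th) => x /= ux.
  have [Ox|nOx] := pselect (Omega x); last by exfalso; apply: ux => /nOx.
  have [T TTh xT] := cover x Ox; exists T => //; split=> // oxT; apply: ux => _.
  by rewrite (piecewise_agree _ _ _ _ aF TTh xT); apply: up => //; exact: open_box_interior.
- move=> alpha alpha2; pose s := nseq (alpha (inord 0)) (inord 0) ++
    nseq (alpha (inord 1)) (inord 1) ++ nseq (alpha (inord 2)) (inord 2) : seq 'I_3.
  have szs : size s = (\sum_i alpha i)%N.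
    rewrite !size_cat !size_nseq !big_ord_recr big_ord0 /= add0n -addnA.
    by congr (alpha _ + (alpha _ + alpha _))%N; apply/val_inj; rewrite /= inordK.
  rewrite -szs in alpha2.
  have [G sG wG] := piecewise_weak_partial Omega Th F s oO cover sF aF adF alpha2.
  exists (piecewise Th G); split; first exact: L2pw.
  by move=> phi tphi; rewrite -szs multi_partialE; exact: wG.
Qed.

End Conformity.

Theorem proposition3p2 (R : realType) (k : nat) (hk : (3 <= k)%N) :
  (forall (T : box R) (hT : cuboid T)
     (b : forall G : box R, order01 -> seq (moment_space k G))
     (hb : forall G alpha, basis_of {: moment_space k G} (b G alpha)),
     unisolvent (dofs T b))
  /\
  (forall (Omega : set (space3 R)) (Th : seq (box R)),
     open Omega -> connected Omega -> contractible Omega ->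
     lipschitz_boundary Omega -> is_mesh Omega Th ->
     fe_space k Omega Th `<=` sobolevH2 Omega).
Proof.
split=> [T hT b hb|Omega Th oOmega _ _ _ mesh]; first exact: dofs_unisolvent.
exact: fe_space_sobolevH2.
Qed.
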